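(* Let $\mathcal{C}$ be a cooperad in chain complexes over a commutative ring $\Bbbk$, let $A,B$ be $\mathcal{C}$-coalgebras, and let $\mathbf{f}\colon A\to B$, $\mathbf{g}\colon B\to A$, $\mathbf{h}\colon A\to A$ be a contraction of $\mathcal{C}$-coalgebras. Let $\mathbf{t}$ be a perturbation of the $\mathcal{C}$-coalgebra $A$ such that the series $\mathbf{t}+\mathbf{t}\mathbf{h}\mathbf{t}+\mathbf{t}\mathbf{h}\mathbf{t}\mathbf{h}\mathbf{t}+\cdots$ converges, in the sense that $\mathbf{1}-\mathbf{h}\mathbf{t}$ is invertible (equivalently $\mathbf{1}-\mathbf{t}\mathbf{h}$ is invertible; the sum of the series is $\mathbf{t}(\mathbf{1}-\mathbf{h}\mathbf{t})^{-1}$). Then the recursive formulas $$\mathbf{f}'=\mathbf{f}+\mathbf{f}'\mathbf{t}\mathbf{h},\qquad \mathbf{g}'=\mathbf{g}+\mathbf{h}\mathbf{t}\mathbf{g}',\qquad \mathbf{h}'=\mathbf{h}+\mathbf{h}'\mathbf{t}\mathbf{h},\qquad \mathbf{t}'=\mathbf{f}\mathbf{t}\mathbf{g}'$$ define a perturbation $\mathbf{t}'$ of the $\mathcal{C}$-coalgebra $B$ and a contraction of $\mathcal{C}$-coalgebras $$\mathbf{f}'\colon (A,d_A+\mathbf{t}_1)\to (B,d_B+\mathbf{t}'_1),\quad \mathbf{g}'\colon (B,d_B+\mathbf{t}'_1)\to (A,d_A+\mathbf{t}_1),\quad \mathbf{h}'\colon (A,d_A+\mathbf{t}_1)\to (A,d_A+\mathbf{t}_1).$$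 In particular, $\mathbf{f}'$ and $\mathbf{g}'$ are morphisms, $\mathbf{t}'$ is a coderivation and $\mathbf{h}'$ is a pseudo-derivation.
   Context: Chain complexes are unbounded complexes over $\Bbbk$ with differential of degree $-1$; the Koszul sign rule is used. A thick map $\mathbf{f}\colon A\to B$ is a sequence of maps $\mathbf{f}_n\colon A^{\otimes n}\to B^{\otimes n}$, $n\ge0$, all of the same degree $|\mathbf{f}|$; it is symmetric if each $\mathbf{f}_n$ is $\Sigma_n$-equivariant. Composition, sums and $\partial(\mathbf{f})_n=d_{B^{\otimes n}}\mathbf{f}_n-(-1)^{|\mathbf{f}|}\mathbf{f}_nd_{A^{\otimes n}}$ are levelwise; $\mathbf{1}_n=1$, $\mathbf{0}_n=0$. A thick map is a morphism if $\mathbf{f}_{p+q}=\mathbf{f}_p\otimes\mathbf{f}_q$ for all $p,q\ge0$. A thick map $\mathbf{h}\colon A\to A$ (of degree $1$) is a pseudo-derivation if for all $p,q\ge0$ $$(\mathbf{h}_p\otimes 1-1\otimes\mathbf{h}_q)\mathbf{h}_{p+q}=\mathbf{h}_p\otimes\mathbf{h}_q,\qquad \mathbf{h}_{p+q}(\mathbf{h}_p\otimes 1-1\otimes\mathbf{h}_q)=-\mathbf{h}_p\otimes\mathbf{h}_q .$$ For a cooperad $\mathcal{C}$, put $\mathcal{C}[A]=\bigoplus_{n\ge0}\mathcal{C}(n)\otimes_{\Sigma_n}A^{\otimes n}$ and $\mathcal{C}[\mathbf{f}]=\bigoplus_n1\otimes_{\Sigma_n}\mathbf{f}_n$ for a symmetric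 thick map $\mathbf{f}$. A $\mathcal{C}$-coalgebra is a coalgebra $\Delta_A\colon A\to\mathcal{C}[A]$ over the comonad $\mathcal{C}[-]$. A thick map of $\mathcal{C}$-coalgebras $A\to B$ is a symmetric thick map with $\Delta_B\mathbf{f}_1=\mathcal{C}[\mathbf{f}]\Delta_A$. A coderivation of $A$ is a thick map of $\mathcal{C}$-coalgebras $\mathbf{d}\colon A\to A$ with $\mathbf{d}_{p+q}=\mathbf{d}_p\otimes1+1\otimes\mathbf{d}_q$ for all $p,q\ge0$. A perturbation of a $\mathcal{C}$-coalgebra $A$ is a coderivation $\mathbf{t}$ of degree $-1$ with $\partial(\mathbf{t})+\mathbf{t}^2=\mathbf{0}$; then $(A,d_A+\mathbf{t}_1)$ denotes $A$ with the new differential and the same structure map. A contraction of $\mathcal{C}$-coalgebras consists of thick maps of $\mathcal{C}$-coalgebras $\mathbf{f}\colon A\to B$, $\mathbf{g}\colon B\to A$, $\mathbf{h}\colon A\to A$ of degrees $0,0,1$ with $\partial(\mathbf{f})=\mathbf{0}$, $\partial(\mathbf{g})=\mathbf{0}$, $\partial(\mathbf{h})=\mathbf{g}\mathbf{f}-\mathbf{1}$, $\mathbf{f}\mathbf{g}=\mathbf{1}$, $\mathbf{f}\mathbf{h}=\mathbf{0}$, $\mathbf{h}\mathbf{h}=\mathbf{0}$, $\mathbf{h}\mathbf{g}=\mathbf{0}$, where $\mathbf{f},\mathbf{g}$ are morphisms and $\mathbf{h}$ is a pseudo-derivation. *)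

(* Defs.v *)
Set Warnings "-notation-overridden,-ambiguous-paths,-redundant-canonical-projection".
From HB Require Import structures.
From mathcomp Require Import all_boot all_algebra perm fingroup.
From mathcomp Require Import generic_quotient boolp.

Set Implicit Arguments.
Unset Strict Implicit.
Unset Printing Implicit Defensive.
Import GRing.Theory.
Local Open Scope ring_scope.
Local Open Scope quotient_scope.

Section Presented.
Variables (k : comPzRingType) (X : Type).
Definition fsum : Type := seq (k * X).

Definition feval (V : lmodType k) (phi : X -> V) (s : fsum) : V :=
  \sum_(p <- s) p.1 *: phi p.2.

Variable Rel : fsum -> Prop.

Definition respects (V : lmodType k) (phi : X -> V) : Prop :=
  forall s, Rel s -> feval phi s = 0.

Definition fequiv (s t : {classic fsum}) : bool :=
  `[< forall (V : lmodType k) (phi : X -> V),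
        respects phi -> feval phi s = feval phi t >].

Lemma fequiv_refl : reflexive fequiv.
Proof. by move=> s; apply/asboolP. Qed.
Lemma fequiv_sym : symmetric fequiv.
Proof.
by move=> s t; apply/asboolP/asboolP => H V phi r; rewrite H.
Qed.
Lemma fequiv_trans : transitive fequiv.
Proof.
by move=> s t u /asboolP H1 /asboolP H2; apply/asboolP => V phi r; rewrite H1 ?H2.
Qed.

Canonical fequiv_rel := EquivRel fequiv fequiv_refl fequiv_sym fequiv_trans.

Definition pmod : Type := {eq_quot fequiv_rel}.
HB.instance Definition _ := Choice.copy pmod {eq_quot fequiv_rel}.

Definition pcls (s : fsum) : pmod := \pi_{eq_quot fequiv_rel} (s : {classic fsum}).
Definition prep (u : pmod) : fsum := repr (u : {eq_quot fequiv_rel}).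

Lemma pclsP s t :
  (forall (V : lmodType k) (phi : X -> V), respects phi -> feval phi s = feval phi t) ->
  pcls s = pcls t.
Proof. by move=> H; apply/eqmodP/asboolP. Qed.

Lemma prepK u : pcls (prep u) = u.
Proof. exact: reprK. Qed.

Lemma feval_prep (V : lmodType k) (phi : X -> V) s :
  respects phi -> feval phi (prep (pcls s)) = feval phi s.
Proof.
move=> r; have /eqmodP/asboolP : pcls (prep (pcls s)) = pcls s by rewrite prepK.
exact.
Qed.

Lemma pmodP (u v : pmod) :
  (forall (V : lmodType k) (phi : X -> V), respects phi ->
     feval phi (prep u) = feval phi (prep v)) -> u = v.
Proof. by move=> H; rewrite -(prepK u) -(prepK v); apply: pclsP. Qed.

Definition fscale (c : k) (s : fsum) : fsum := [seq (c * p.1, p.2) | p <- s].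

Lemma feval_cat (V : lmodType k) (phi : X -> V) s t : feval phi (s ++ t) = feval phi s + feval phi t.
Proof. by rewrite /feval big_cat. Qed.
Lemma feval_scale (V : lmodType k) (phi : X -> V) c s : feval phi (fscale c s) = c *: feval phi s.
Proof.
rewrite /feval /fscale big_map scaler_sumr.
by apply: eq_bigr => p _; rewrite scalerA.
Qed.
Lemma feval_nil (V : lmodType k) (phi : X -> V) : feval phi [::] = 0.
Proof. exact: big_nil. Qed.
Lemma feval1 (V : lmodType k) (phi : X -> V) c x : feval phi [:: (c, x)] = c *: phi x.
Proof. exact: big_seq1. Qed.

Definition pzero : pmod := pcls [::].
Definition padd (u v : pmod) : pmod := pcls (prep u ++ prep v).
Definition popp (u : pmod) : pmod := pcls (fscale (-1) (prep u)).
Definition pscale c (u : pmod) : pmod := pcls (fscale c (prep u)).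

Ltac pmod_tac :=
  apply: pmodP => V phi r;
  rewrite ?(feval_prep, feval_cat, feval_scale, feval_nil) //.

Lemma paddA : associative padd.
Proof. move=> u v w; pmod_tac. by rewrite addrA. Qed.
Lemma paddC : commutative padd.
Proof. move=> u v; pmod_tac. by rewrite addrC. Qed.
Lemma padd0 : left_id pzero padd.
Proof. move=> u; pmod_tac. by rewrite add0r. Qed.
Lemma paddN : left_inverse pzero popp padd.
Proof. move=> u; pmod_tac. by rewrite scaleN1r addNr. Qed.

HB.instance Definition _ := GRing.isZmodule.Build pmod paddA paddC padd0 paddN.

Lemma pscaleA a b u : pscale a (pscale b u) = pscale (a * b) u.
Proof. pmod_tac. by rewrite scalerA. Qed.
Lemma pscale1 : left_id 1 pscale.
Proof. move=> u; pmod_tac. by rewrite scale1r. Qed.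
Lemma pscaleDr : right_distributive pscale +%R.
Proof. move=> a u v; pmod_tac. by rewrite scalerDr. Qed.
Lemma pscaleDl u : {morph pscale^~ u : a b / a + b}.
Proof. move=> a b; pmod_tac. by rewrite scalerDl. Qed.

HB.instance Definition _ :=
  GRing.Zmodule_isLmodule.Build k pmod pscaleA pscale1 pscaleDr pscaleDl.

Definition pgen (x : X) : pmod := pcls [:: (1, x)].

Section Lift.
Variables (V : lmodType k) (phi : X -> V).

Definition plift (u : pmod) : V :=
  if pselect (respects phi) then feval phi (prep u) else 0.

Lemma plift_linear : linear plift.
Proof.
move=> c u v; rewrite /plift; case: pselect => [r|nr] /=; last by rewrite scaler0 addr0.
by have -> : c *: u + v = padd (pscale c u) v by []; rewrite !(feval_prep, feval_cat, feval_scale).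
Qed.

HB.instance Definition _ := GRing.isLinear.Build k pmod V _ plift plift_linear.

Lemma plift_gen x : respects phi -> plift (pgen x) = phi x.
Proof.
by move=> r; rewrite /plift; case: pselect => // r2; rewrite feval_prep // feval1 scale1r.
Qed.

Lemma pliftE u : respects phi -> plift u = feval phi (prep u).
Proof. by move=> r; rewrite /plift; case: pselect. Qed.
End Lift.

Lemma pcls_sum (s : fsum) : pcls s = \sum_(p <- s) p.1 *: pgen p.2.
Proof.
elim: s => [|[c x] s IH]; first by rewrite big_nil.
rewrite big_cons -IH /=.
have -> : c *: pgen x + pcls s = padd (pscale c (pgen x)) (pcls s) by [].
pmod_tac; rewrite [in RHS]feval1 scale1r -[X in _ = X + _]feval1.
by rewrite -feval_cat.
Qed.

Lemma prep_sum (u : pmod) : u = \sum_(p <- prep u) p.1 *: pgen p.2.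
Proof. by rewrite -pcls_sum prepK. Qed.

Lemma respects_pgen : respects pgen.
Proof.
move=> s Rs; rewrite /feval -pcls_sum.
by apply: (@pclsP _ [::]) => V phi r; rewrite r // feval_nil.
Qed.

Lemma plin_ext (V : lmodType k) (F G : {linear pmod -> V}) :
  (forall x, F (pgen x) = G (pgen x)) -> F =1 G.
Proof.
move=> H u; rewrite (prep_sum u) !linear_sum; apply: eq_bigr => p _.
by rewrite !linearZ /= H.
Qed.
End Presented.
Arguments pgen {k X} Rel x.
Arguments plift {k X} Rel {V} phi u.
Definition upd (I : eqType) (T : I -> Type) (x : forall i, T i) (i : I) (y : T i) :
  forall j, T j := dfwith x y.
Arguments upd {I T} x i y.

Section Graded.
Variable k : comPzRingType.

Record gmod := GMod {
  gcar :> lmodType k;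
  gr : int -> gcar -> Prop;
  gr0 : forall m, gr m 0;
  grP : forall m c x y, gr m x -> gr m y -> gr m (c *: x + y);
  gr_span : forall x, exists (n : nat) (d : 'I_n -> int) (a : 'I_n -> gcar),
    (forall i, gr (d i) (a i)) /\ x = \sum_i a i;
  gr_direct : forall (n : nat) (d : 'I_n -> int) (a : 'I_n -> gcar),
    injective d -> (forall i, gr (d i) (a i)) -> \sum_i a i = 0 ->
    forall i, a i = 0
}.

Arguments gr : simpl never.
Arguments gcar : simpl never.

Lemma grZ (A : gmod) m c (x : A) : gr m x -> gr m (c *: x).
Proof. by move=> Hx; rewrite -[_ *: _]addr0; apply: grP => //; apply: gr0. Qed.
Lemma grD (A : gmod) m (x y : A) : gr m x -> gr m y -> gr m (x + y).
Proof. by move=> Hx Hy; rewrite -[x]scale1r; apply: grP. Qed.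
Lemma gr_sum (A : gmod) m (I : Type) (s : seq I) (P : pred I) (F : I -> A) :
  (forall i, P i -> gr m (F i)) -> gr m (\sum_(i <- s | P i) F i).
Proof.
by move=> H; elim/big_ind: _ => //; [exact: gr0 | move=> *; exact: grD].
Qed.

Record hel (A : gmod) := Hel { hdeg : int; hval : A; helP : gr hdeg hval }.

Record gmap (r : int) (A B : gmod) := GMap {
  gfun :> {linear A -> B};
  gfunP : forall m x, gr m x -> gr (m + r) (gfun x)
}.

Definition hmap r A B (f : gmap r A B) (h : hel A) : hel B := Hel (gfunP f (helP h)).

Section PresentedGraded.
Variables (X : Type) (deg : X -> int) (Rel : fsum k X -> Prop).
Hypothesis Rel_homog :
  forall s, Rel s -> exists m, all (fun p => deg p.2 == m) s.

Definition pgr (m : int) (u : pmod Rel) : Prop :=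
  exists2 s : fsum k X, all (fun p => deg p.2 == m) s & u = pcls Rel s.

Lemma pgr0 m : pgr m 0.
Proof. by exists [::]. Qed.

Lemma pgrP m c x y : pgr m x -> pgr m y -> pgr m (c *: x + y).
Proof.
move=> [s Hs ->] [t Ht ->]; exists (fscale c s ++ t).
  by rewrite all_cat Ht andbT /fscale all_map.
have E u : pcls Rel u = feval (pgen Rel) u by exact: pcls_sum.
by rewrite !E feval_cat feval_scale.
Qed.

Lemma pgr_gen x : pgr (deg x) (pgen Rel x).
Proof. by exists [:: (1, x)] => //=; rewrite eqxx. Qed.

Lemma pgr_span (u : pmod Rel) :
  exists (n : nat) (d : 'I_n -> int) (a : 'I_n -> pmod Rel),
    (forall i, pgr (d i) (a i)) /\ u = \sum_i a i.
Proof.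
pose s := prep u; exists (size s).
exists (fun i => deg (tnth (in_tuple s) i).2).
exists (fun i => (tnth (in_tuple s) i).1 *: pgen Rel (tnth (in_tuple s) i).2).
split=> [i|]; last by rewrite {1}(prep_sum u) -/s big_tnth.
rewrite -[_ *: _]addr0; apply: pgrP; [exact: pgr_gen|exact: pgr0].
Qed.

Definition pproj m := plift Rel (fun x => if deg x == m then pgen Rel x else 0).

Lemma pproj_respects m :
  respects Rel (fun x => if deg x == m then pgen Rel x else 0).
Proof.
move=> s Rs; have [m' Hs] := Rel_homog Rs.
have E : feval (fun x => if deg x == m then pgen Rel x else 0) s
         = if m' == m then feval (pgen Rel) s else 0.
  elim: s Hs {Rs} => [|[c x] s IH] /=; first by rewrite !feval_nil if_same.
  case/andP=> /eqP Hx /IH; rewrite /feval !big_cons /= Hx => ->.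
  by case: eqP => _ //; rewrite scaler0 add0r.
by rewrite E respects_pgen // if_same.
Qed.

Lemma pprojE m m' u : pgr m' u -> pproj m u = if m' == m then u else 0.
Proof.
rewrite /pproj; case=> s + ->; rewrite pcls_sum linear_sum /=.
elim: s => [|[c x] s IH] /=; first by rewrite !big_nil if_same.
case/andP=> /eqP Hx /IH; rewrite !big_cons => ->; rewrite linearZ /= plift_gen.
  by rewrite Hx; case: eqP => _ //; rewrite scaler0 add0r.
exact: pproj_respects.
Qed.

Lemma pgr_direct (n : nat) (d : 'I_n -> int) (a : 'I_n -> pmod Rel) :
  injective d -> (forall i, pgr (d i) (a i)) -> \sum_i a i = 0 ->
  forall i, a i = 0.
Proof.
move=> dI Ha S i; have := congr1 (pproj (d i)) S; rewrite {1 2}/pproj linear0 linear_sum /= -/(pproj _).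
rewrite (bigD1 i) //= (pprojE _ (Ha i)) eqxx big1 ?addr0 // => j ji.
by rewrite (pprojE _ (Ha j)) (inj_eq dI) (negbTE ji).
Qed.

Definition pgmod : gmod := GMod pgr0 pgrP pgr_span pgr_direct.

Lemma plift_homog r (B : gmod) (phi : X -> B) :
  (forall x, gr (deg x + r) (phi x)) ->
  forall m (u : pgmod), gr m u -> gr (m + r) (plift Rel phi u).
Proof.
move=> H m u [s Hs ->]; rewrite pcls_sum linear_sum /=.
elim: s Hs => [|[c x] s IH] /=; first by rewrite big_nil => _; exact: gr0.
case/andP=> /eqP Hx /IH Hs; rewrite big_cons linearZ /=; apply: grP => //=.
rewrite -Hx /plift; case: pselect => [R|nR] /=; last exact: gr0.
by rewrite feval_prep // feval1 scale1r.
Qed.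

Definition gplift r (B : gmod) (phi : X -> B) (H : forall x, gr (deg x + r) (phi x)) :
  gmap r pgmod B := @GMap r pgmod B (plift Rel phi) (plift_homog H).
End PresentedGraded.

Arguments pgmod : simpl never.

Definition hlinear (A : gmod) (V : lmodType k) (phi : hel A -> V) : Prop :=
  forall c (h h1 h2 : hel A), hdeg h1 = hdeg h -> hdeg h2 = hdeg h ->
    hval h = c *: hval h1 + hval h2 -> phi h = c *: phi h1 + phi h2.

Lemma hlinear0 (A : gmod) (V : lmodType k) (phi : hel A -> V) (h : hel A) :
  hlinear phi -> hval h = 0 -> phi h = 0.
Proof.
move=> L H0; have := L (-1) h h h erefl erefl.
by rewrite H0 scaler0 addr0 scaleN1r addNr; apply.
Qed.

Lemma hel_spanP (A : gmod) (x : A) :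
  exists s : seq (hel A), x = \sum_(h <- s) hval h.
Proof.
have [n [d [a [Ha ->]]]] := gr_span x.
exists [seq Hel (Ha i) | i <- enum 'I_n].
by rewrite big_map big_enum.
Qed.
Definition hdec (A : gmod) (x : A) : seq (hel A) := sval (cid (hel_spanP x)).
Lemma hdecE (A : gmod) (x : A) : \sum_(h <- hdec x) hval h = x.
Proof. by rewrite /hdec; case: cid. Qed.

Lemma hpart (A : gmod) (V : lmodType k) (F : hel A -> V) (ds : seq int) (s : seq (hel A)) :
  uniq ds -> all (fun h => hdeg h \in ds) s ->
  \sum_(h <- s) F h = \sum_(m <- ds) \sum_(h <- s | hdeg h == m) F h.
Proof.
move=> U; elim: s => [|h s IH] /=.
  by move=> _; rewrite big_nil big1 // => m _; rewrite big_nil.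
case/andP=> hd /IH; rewrite big_cons => ->.
transitivity (\sum_(m <- ds) ((if hdeg h == m then F h else 0)
                 + \sum_(h <- s | hdeg h == m) F h)); last first.
  by apply: eq_bigr => m _; rewrite big_cons; case: eqP => //; rewrite add0r.
rewrite big_split /=; congr (_ + _).
rewrite (bigD1_seq (hdeg h)) //= eqxx big1 ?addr0 // => m hm.
by rewrite eq_sym (negbTE hm).
Qed.

Lemma hsum0 (A : gmod) (V : lmodType k) (phi : hel A -> V) (s : seq (hel A)) :
  hlinear phi -> \sum_(h <- s) hval h = 0 -> \sum_(h <- s) phi h = 0.
Proof.
move=> L S0; pose ds := undup (map (@hdeg A) s).
have U : uniq ds by exact: undup_uniq.
have Ain : all (fun h => hdeg h \in ds) s.
  have : all (mem (map (@hdeg A) s)) (map (@hdeg A) s) by apply/allP.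
  by rewrite all_map; apply: sub_all => h /=; rewrite mem_undup.
rewrite (hpart phi U Ain).
have grS m : gr m (\sum_(h <- s | hdeg h == m) hval h).
  by apply: gr_sum => h /eqP <-; exact: helP.
have Z m : m \in ds -> \sum_(h <- s | hdeg h == m) hval h = 0.
  move=> /(nthP 0) [i Hi <-].
  have := @gr_direct A (size ds) (fun i => nth 0 ds i)
    (fun i : 'I_(size ds) => \sum_(h <- s | hdeg h == nth 0 ds i) hval h).
  move=> /(_ _ (fun i => grS _) _ (Ordinal Hi)); apply.
    by move=> a b /eqP; rewrite nth_uniq // => /eqP/val_inj.
  by rewrite -[RHS]S0 (hpart (@hval A) U Ain) (big_nth 0) big_mkord.
rewrite big_seq big1 // => m /Z Zm.
have P : \sum_(h <- s | hdeg h == m) phi h = phi (Hel (grS m)).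
  move: (grS m); clear -L; elim: s => [|h s IH].
    by rewrite !big_nil => g; rewrite hlinear0.
  rewrite !big_cons; case: eqP => // hm g.
  have g' : gr m (\sum_(h <- s | hdeg h == m) hval h).
    by apply: gr_sum => h' /eqP <-; exact: helP.
  rewrite (IH g'); symmetry; rewrite -[phi h]scale1r; apply: L => //=.
  by rewrite scale1r.
by rewrite P hlinear0 //= Zm.
Qed.

Lemma hsum_eq (A : gmod) (V : lmodType k) (phi : hel A -> V) (s t : seq (hel A)) :
  hlinear phi -> \sum_(h <- s) hval h = \sum_(h <- t) hval h ->
  \sum_(h <- s) phi h = \sum_(h <- t) phi h.
Proof.
move=> L E; apply/eqP; rewrite -subr_eq0; apply/eqP.
have g (h : hel A) : gr (hdeg h) (- hval h) by rewrite -scaleN1r; apply/grZ/helP.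
pose u := [seq Hel (g h) | h <- t].
have N (h : hel A) : phi (Hel (g h)) = - phi h.
  have gz : gr (hdeg h) (0 : A) by exact: gr0.
  rewrite -[RHS]scaleN1r -[RHS]addr0 -(@hlinear0 _ _ phi (Hel gz)) //.
  by apply: L => //=; rewrite addr0 scaleN1r.
have := @hsum0 _ _ phi (s ++ u) L; rewrite !big_cat !big_map /=.
rewrite E -(eq_bigr _ (fun h _ => esym (N h))) !sumrN; apply.
by rewrite subrr.
Qed.

Section HLift.
Variables (A : gmod) (V : lmodType k) (phi : hel A -> V).

Definition hlift (x : A) : V :=
  if pselect (hlinear phi) then \sum_(h <- hdec x) phi h else 0.

Lemma hlift_linear : linear hlift.
Proof.
move=> c x y; rewrite /hlift; case: pselect => [L|nL] /=; last by rewrite scaler0 addr0.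
have g (h : hel A) : gr (hdeg h) (c *: hval h) by apply/grZ/helP.
have N (h : hel A) : phi (Hel (g h)) = c *: phi h.
  have gz : gr (hdeg h) (0 : A) by exact: gr0.
  rewrite -[RHS]addr0 -(@hlinear0 _ _ phi (Hel gz)) //.
  by apply: L => //=; rewrite addr0.
pose u := [seq Hel (g h) | h <- hdec x] ++ hdec y.
rewrite (@hsum_eq _ _ phi _ u L) /u; last first.
  by rewrite hdecE big_cat big_map /= -scaler_sumr !hdecE.
by rewrite big_cat big_map /= (eq_bigr _ (fun h _ => N h)) scaler_sumr.
Qed.
HB.instance Definition _ := GRing.isLinear.Build k A V _ hlift hlift_linear.

Lemma hliftE (h : hel A) : hlinear phi -> hlift (hval h) = phi h.
Proof.
move=> L; rewrite /hlift; case: pselect => // L' /=.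
by rewrite (@hsum_eq _ _ phi _ [:: h] L) ?big_seq1 // hdecE.
Qed.
End HLift.

Lemma hlift_homog r (A B : gmod) (phi : hel A -> B) :
  (forall h, gr (hdeg h + r) (phi h)) ->
  forall m (x : A), gr m x -> gr (m + r) (hlift phi x).
Proof.
move=> H m x Hx; have [L|nL] := pselect (hlinear phi).
  by rewrite (@hliftE A B phi (Hel Hx) L); exact: (H (Hel Hx)).
by rewrite /hlift; case: pselect => //= ?; exact: gr0.
Qed.

Definition ghlift r (A B : gmod) (phi : hel A -> B)
  (H : forall h, gr (hdeg h + r) (phi h)) : gmap r A B := GMap (hlift_homog H).

Lemma gid_homog (A : gmod) m (x : A) : gr m x -> gr (m + 0) (idfun x).
Proof. by rewrite addr0. Qed.
Definition gid (A : gmod) : gmap 0 A A := @GMap 0 A A idfun (@gid_homog A).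

Definition koszul (m n : int) : k := (-1) ^+ (odd `|m| && odd `|n|)%N.

Definition perm_sign n (s : 'S_n) (d : 'I_n -> int) : k :=
  \prod_(i < n) \prod_(j < n | (i < j)%N && (s j < s i)%N) koszul (d (s i)) (d (s j)).

Section Tensor.
Variable A : gmod.

Definition tdeg n (a : 'I_n -> hel A) : int := \sum_(i < n) hdeg (a i).

Inductive tensor_rel n : fsum k ('I_n -> hel A) -> Prop :=
  TensorRel (a : 'I_n -> hel A) i c (x x1 x2 : hel A) of
    hdeg x1 = hdeg x & hdeg x2 = hdeg x & hval x = c *: hval x1 + hval x2 :
  tensor_rel [:: (1, upd a i x); (- c, upd a i x1); (-1, upd a i x2)].

Lemma tdeg_upd n (a : 'I_n -> hel A) i (x y : hel A) :
  hdeg x = hdeg y -> tdeg (upd a i x) = tdeg (upd a i y).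
Proof.
move=> E; apply: eq_bigr => j _; rewrite /upd.
by case: dfwithP => [|j' ij]; [rewrite dfwith_in | rewrite dfwith_out].
Qed.

Lemma tensor_rel_homog n s :
  @tensor_rel n s -> exists m, all (fun p => tdeg p.2 == m) s.
Proof.
case=> a i c x x1 x2 E1 E2 _; exists (tdeg (upd a i x)).
by rewrite /= eqxx (tdeg_upd _ _ E1) (tdeg_upd _ _ E2) !eqxx.
Qed.

Definition tpow n : gmod := pgmod (@tensor_rel_homog n).
Arguments tpow : simpl never.
Definition tgen n (a : 'I_n -> hel A) : tpow n := pgen (@tensor_rel n) a.
Lemma tgen_gr n (a : 'I_n -> hel A) : gr (tdeg a) (tgen a).
Proof. exact: pgr_gen. Qed.

End Tensor.
Arguments tpow : simpl never.

Section TensorMaps.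
Variables (A B : gmod).

Definition acat T p q (a : 'I_p -> T) (b : 'I_q -> T) (i : 'I_(p + q)) : T :=
  match split i with inl j => a j | inr j => b j end.

Definition tcat p q (x : tpow A p) (y : tpow A q) : tpow A (p + q) :=
  plift (@tensor_rel A p)
    (fun a => plift (@tensor_rel A q) (fun b => tgen (acat a b)) y) x.

Lemma tdeg_acat p q (a : 'I_p -> hel A) (b : 'I_q -> hel A) :
  tdeg (acat a b) = tdeg a + tdeg b.
Proof.
rewrite /tdeg big_split_ord /=; congr (_ + _); apply: eq_bigr => i _; congr hdeg;
  rewrite /acat; [case: splitP | case: splitP] => j /= E.
- by congr a; apply: val_inj.
- by have := ltn_ord i; rewrite E ltnNge leq_addr.
- by have := ltn_ord j; rewrite -E ltnNge leq_addr.
- by congr b; apply: val_inj; apply: (@addnI p).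
Qed.

Lemma tcat_gr p q m m' (x : tpow A p) (y : tpow A q) :
  gr m x -> gr m' y -> gr (m + m') (tcat x y).
Proof.
move=> Hx Hy; rewrite /tcat; apply: plift_homog Hx => a.
rewrite addrC; apply: plift_homog Hy => b; rewrite addrC -tdeg_acat; exact: tgen_gr.
Qed.
End TensorMaps.

Section TensorMaps2.
Variables (A B : gmod).

Definition tens_gen r s p q (f : gmap r (tpow A p) (tpow B p))
    (g : gmap s (tpow A q) (tpow B q)) (a : 'I_(p + q) -> hel A) : tpow B (p + q) :=
  let a1 : 'I_p -> hel A := fun i => a (lshift q i) in
  let a2 : 'I_q -> hel A := fun i => a (rshift p i) in
  koszul s (tdeg a1) *: tcat (f (tgen a1)) (g (tgen a2)).

Lemma tens_gen_gr r s p q (f : gmap r (tpow A p) (tpow B p))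
    (g : gmap s (tpow A q) (tpow B q)) a :
  gr (tdeg a + (r + s)) (tens_gen f g a).
Proof.
rewrite /tens_gen {1}/tdeg big_split_ord /= addrACA. apply: grZ.
by apply: tcat_gr; apply: gfunP; exact: tgen_gr.
Qed.

Definition tens r s p q f g : gmap (r + s) (tpow A (p + q)) (tpow B (p + q)) :=
  gplift (@tensor_rel_homog A (p + q)) (@tens_gen_gr r s p q f g).
End TensorMaps2.

Section TensorMaps3.
Variable A : gmod.

Definition tperm_gen n (s : 'S_n) (a : 'I_n -> hel A) : tpow A n :=
  perm_sign s (fun i => hdeg (a i)) *: tgen (fun i => a (s i)).
Lemma tperm_gen_gr n (s : 'S_n) (a : 'I_n -> hel A) :
  gr (tdeg a + 0) (tperm_gen s a).
Proof.
apply: grZ; rewrite addr0 /tdeg (reindex_inj (@perm_inj _ s)); exact: tgen_gr.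
Qed.
Definition tperm n (s : 'S_n) : gmap 0 (tpow A n) (tpow A n) :=
  gplift (@tensor_rel_homog A n) (tperm_gen_gr s).

Definition tin_gen (h : hel A) : tpow A 1 := tgen (fun _ : 'I_1 => h).
Lemma tin_gen_gr (h : hel A) : gr (hdeg h + 0) (tin_gen h).
Proof.
have -> : hdeg h + 0 = tdeg (fun _ : 'I_1 => h) by rewrite addr0 /tdeg big_ord1.
exact: tgen_gr.
Qed.
Definition tin : gmap 0 A (tpow A 1) := ghlift tin_gen_gr.

Lemma tout_gr (a : 'I_1 -> hel A) : gr (tdeg a + 0) (hval (a ord0)).
Proof. by rewrite addr0 /tdeg big_ord1; exact: helP. Qed.
Definition tout : gmap 0 (tpow A 1) A := gplift (@tensor_rel_homog A 1) tout_gr.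

Definition tdiff_gen (d : gmap (-1) A A) n (a : 'I_n -> hel A) : tpow A n :=
  \sum_(i < n) koszul (-1) (\sum_(j < n | (j < i)%N) hdeg (a j))
                 *: tgen (upd a i (hmap d (a i))).
Lemma tdiff_gen_gr d n (a : 'I_n -> hel A) : gr (tdeg a + -1) (tdiff_gen d a).
Proof.
apply: gr_sum => i _; apply: grZ.
have -> : tdeg a + -1 = tdeg (upd a i (hmap d (a i))); last exact: tgen_gr.
rewrite /tdeg (bigD1 i) // [RHS](bigD1 i) //= /upd dfwith_in /= addrAC.
by congr (_ + _); apply: eq_bigr => j ji; rewrite dfwith_out // eq_sym.
Qed.
Definition tdiff d n : gmap (-1) (tpow A n) (tpow A n) :=
  gplift (@tensor_rel_homog A n) (@tdiff_gen_gr d n).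
End TensorMaps3.

Definition thick r (A B : gmod) := forall n, gmap r (tpow A n) (tpow B n).

Definition symmetric_thick r A B (f : thick r A B) : Prop :=
  forall n (s : 'S_n) x, f n (tperm A s x) = tperm B s (f n x).

Definition tone A : thick 0 A A := fun n => gid (tpow A n).

Lemma pert_diff_linear A (d : gmap (-1) A A) (t : thick (-1) A A) :
  linear (fun x => d x + tout A (t 1%N (tin A x))).
Proof. by move=> c x y; rewrite !linearP /= scalerDr addrACA. Qed.
Definition pert_fun A (d : gmap (-1) A A) (t : thick (-1) A A) (x : A) : A :=
  d x + tout A (t 1%N (tin A x)).
HB.instance Definition _ (A : gmod) d t :=
  GRing.isLinear.Build k A A _ (pert_fun d t) (@pert_diff_linear A d t).
Lemma pert_gr (A : gmod) d t m (x : A) : gr m x -> gr (m + -1) (pert_fun d t x).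
Proof.
move=> H; apply: grD; first exact: gfunP.
by have := gfunP (tout A) (gfunP (t 1%N) (gfunP (tin A) H)); rewrite !addr0.
Qed.
Definition pert_diff A (d : gmap (-1) A A) (t : thick (-1) A A) : gmap (-1) A A :=
  GMap (@pert_gr A d t).

Record symseq := SymSeq {
  sq :> nat -> gmod;
  sact : forall n, 'S_n -> gmap 0 (sq n) (sq n);
  sdiff : forall n, gmap (-1) (sq n) (sq n);
  sact1 : forall n x, sact (1%g : 'S_n) x = x;
  sactM : forall n (s t : 'S_n) x, sact t (sact s x) = sact (t * s)%g x;
  sdiffK : forall n x, sdiff n (sdiff n x) = 0;
  sdiff_act : forall n (s : 'S_n) x, sdiff n (sact s x) = sact s (sdiff n x)
}.

Record sgen (C : symseq) (A : gmod) :=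
  SGen { sar : nat; sop : hel (C sar); sarg : 'I_sar -> hel A }.
Arguments sarg {C A} s _.

Section Schur.
Variable C : symseq.

Section SchurObj.
Variable A : gmod.

Local Notation sgen := (sgen C A).
Definition sdeg (x : sgen) : int := hdeg (sop x) + tdeg (sarg x).

Inductive schur_rel : fsum k sgen -> Prop :=
| SchurOp n c (h h1 h2 : hel (C n)) a of
    hdeg h1 = hdeg h & hdeg h2 = hdeg h & hval h = c *: hval h1 + hval h2 :
    schur_rel [:: (1, SGen h a); (- c, SGen h1 a); (-1, SGen h2 a)]
| SchurArg n (h : hel (C n)) a i c (x x1 x2 : hel A) of
    hdeg x1 = hdeg x & hdeg x2 = hdeg x & hval x = c *: hval x1 + hval x2 :
    schur_rel [:: (1, SGen h (upd a i x)); (- c, SGen h (upd a i x1));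
                  (-1, SGen h (upd a i x2))]
| SchurSym n (h : hel (C n)) (a : 'I_n -> hel A) (s : 'S_n) :
    schur_rel [:: (1, SGen h a);
                  (- perm_sign s (fun i => hdeg (a i)),
                   SGen (hmap (sact C s) h) (fun i => a (s i)))].

Lemma schur_rel_homog s :
  schur_rel s -> exists m, all (fun p => sdeg p.2 == m) s.
Proof.
case=> [n c h h1 h2 a E1 E2 _|n h a i c x x1 x2 E1 E2 _|n h a s'].
- by exists (hdeg h + tdeg a); rewrite /= /sdeg /= E1 E2 !eqxx.
- exists (hdeg h + tdeg (upd a i x)); rewrite /= /sdeg /=.
  by rewrite (tdeg_upd _ _ E1) (tdeg_upd _ _ E2) !eqxx.
exists (hdeg h + tdeg a); rewrite /= /sdeg /= addr0.
rewrite [tdeg a](_ : _ = tdeg (fun i => a (s' i))) ?eqxx //.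
exact: (reindex_inj (@perm_inj _ s')).
Qed.

Definition schur : gmod := pgmod schur_rel_homog.
Lemma schur_gen_gr x : @gr schur (sdeg x) (pgen schur_rel x).
Proof. exact: pgr_gen. Qed.
Definition schur_gen (x : sgen) : hel schur := Hel (schur_gen_gr x).

Lemma schur_ins_gr n (c : hel (C n)) (a : 'I_n -> hel A) :
  gr (tdeg a + hdeg c) (hval (schur_gen (SGen c a))).
Proof. by rewrite addrC; exact: (helP (schur_gen (SGen c a))). Qed.
Definition schur_ins n (c : hel (C n)) : gmap (hdeg c) (tpow A n) schur :=
  gplift (@tensor_rel_homog A n) (schur_ins_gr c).

Definition schur_diff_gen (d : gmap (-1) A A) (x : sgen) : schur :=
  hval (schur_gen (SGen (hmap (sdiff C (sar x)) (sop x)) (sarg x)))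
  + koszul (-1) (hdeg (sop x)) *: schur_ins (sop x) (tdiff d (sar x) (tgen (sarg x))).
Lemma schur_diff_gen_gr d (x : sgen) : gr (sdeg x + -1) (schur_diff_gen d x).
Proof.
apply: grD.
  by have := helP (schur_gen (SGen (hmap (sdiff C (sar x)) (sop x)) (sarg x)));
    rewrite /sdeg /= addrAC.
apply: grZ; rewrite /sdeg -addrA [hdeg _ + _]addrC.
by apply: gfunP; apply: gfunP; exact: tgen_gr.
Qed.
Definition schur_diff (d : gmap (-1) A A) : gmap (-1) schur schur :=
  gplift schur_rel_homog (schur_diff_gen_gr d).
End SchurObj.

Section SchurMap.
Variables (A B : gmod).

Definition schur_thick_gen r (f : thick r A B) (x : sgen C A) : schur B :=
  koszul r (hdeg (sop x)) *: schur_ins B (sop x) (f (sar x) (tgen (sarg x))).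
Lemma schur_thick_gen_gr r (f : thick r A B) x :
  gr (sdeg x + r) (schur_thick_gen f x).
Proof.
apply: grZ; rewrite /sdeg -addrA [hdeg _ + _]addrC.
by apply: gfunP; apply: gfunP; exact: tgen_gr.
Qed.
Definition schur_thick r (f : thick r A B) : gmap r (schur A) (schur B) :=
  gplift (@schur_rel_homog A) (schur_thick_gen_gr f).

Definition schur_map_gen (f : gmap 0 A B) (x : sgen C A) : schur B :=
  hval (schur_gen (SGen (sop x) (fun i => hmap f (sarg x i)))).
Lemma schur_map_gen_gr (f : gmap 0 A B) x : gr (sdeg x + 0) (schur_map_gen f x).
Proof.
rewrite addr0; have -> : sdeg x = sdeg (SGen (sop x) (fun i => hmap f (sarg x i))).
  by congr (_ + _); apply: eq_bigr => i _; rewrite /= addr0.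
exact: (helP (schur_gen _)).
Qed.
Definition schur_map (f : gmap 0 A B) : gmap 0 (schur A) (schur B) :=
  gplift (@schur_rel_homog A) (schur_map_gen_gr f).
End SchurMap.
End Schur.

Record cgen (C D : symseq) (N : nat) := CGen {
  car : nat;
  cop : hel (C car);
  cin_ar : 'I_car -> nat;
  cin : forall i, hel (D (cin_ar i));
  clab : forall i, 'I_(cin_ar i) -> 'I_N;
  clab_bij : bijective (fun p : {i : 'I_car & 'I_(cin_ar i)} => clab (tagged p))
}.
Arguments CGen {C D N car} cop {cin_ar} cin {clab} clab_bij.
Arguments cin_ar {C D N} c _.
Arguments cin {C D N} c i.
Arguments clab {C D N} c i _.

Section Composite.
Variables (C D : symseq) (N : nat).

Local Notation cgen := (cgen C D N).

Definition cdeg (x : cgen) : int := hdeg (cop x) + \sum_i hdeg (cin x i).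

Inductive comp_rel : fsum k cgen -> Prop :=
| CompOp r m lab b c (h h1 h2 : hel (C r)) (e : forall i : 'I_r, hel (D (m i))) of
    hdeg h1 = hdeg h & hdeg h2 = hdeg h & hval h = c *: hval h1 + hval h2 :
    comp_rel [:: (1, @CGen C D N r h m e lab b); (- c, @CGen C D N r h1 m e lab b);
                 (-1, @CGen C D N r h2 m e lab b)]
| CompIn r m lab b (h : hel (C r)) (e : forall i : 'I_r, hel (D (m i))) i c
    (x x1 x2 : hel (D (m i))) of
    hdeg x1 = hdeg x & hdeg x2 = hdeg x & hval x = c *: hval x1 + hval x2 :
    comp_rel [:: (1, @CGen C D N r h m (upd e i x) lab b);
                 (- c, @CGen C D N r h m (upd e i x1) lab b);
                 (-1, @CGen C D N r h m (upd e i x2) lab b)]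
| CompInSym r m lab b (h : hel (C r)) (e : forall i : 'I_r, hel (D (m i)))
    (s : forall i, 'S_(m i)) b' :
    comp_rel [:: (1, @CGen C D N r h m e lab b);
                 (-1, @CGen C D N r h m (fun i => hmap (sact D (s i)) (e i))
                        (fun i j => lab i (s i j)) b')]
| CompOpSym r m lab b (h : hel (C r)) (e : forall i : 'I_r, hel (D (m i))) (s : 'S_r) b' :
    comp_rel [:: (1, @CGen C D N r h m e lab b);
                 (- perm_sign s (fun i => hdeg (e i)),
                  @CGen C D N r (hmap (sact C s) h) (fun i => m (s i)) (fun i => e (s i))
                     (fun i => lab (s i)) b')].

Lemma comp_rel_homog s : comp_rel s -> exists m, all (fun p => cdeg p.2 == m) s.
Proof.
case=> [r m lab b c h h1 h2 e E1 E2 _|r m lab b h e i c x x1 x2 E1 E2 _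
       |r m lab b h e s' b'|r m lab b h e s' b'].
- by exists (hdeg h + \sum_i hdeg (e i)); rewrite /= /cdeg /= E1 E2 !eqxx.
- exists (hdeg h + \sum_j hdeg (upd e i x j)); rewrite /= /cdeg /= eqxx /= andbT.
  apply/andP; split; apply/eqP; congr (_ + _); apply: eq_bigr => j _;
    by rewrite /upd; have [<-|ij] := eqVneq i j; rewrite ?dfwith_in // !dfwith_out.
- exists (hdeg h + \sum_i hdeg (e i)); rewrite /= /cdeg /= eqxx /= andbT.
  by apply/eqP; congr (_ + _); apply: eq_bigr => j _; rewrite addr0.
exists (hdeg h + \sum_i hdeg (e i)); rewrite /= /cdeg /= eqxx /= andbT addr0.
by rewrite [X in _ == _ + X](reindex_inj (@perm_inj _ s')).
Qed.

Definition comp : gmod := pgmod comp_rel_homog.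

Definition comp_act_gen (s : 'S_N) (x : cgen) : cgen.
Proof.
case: x => r h m e lab b; apply: (@CGen C D N r h m e (fun i j => (s^-1)%g (lab i j))).
exact: bij_comp (injF_bij (@perm_inj _ _)) b.
Defined.
Lemma comp_act_gen_gr s x : gr (cdeg x + 0) (pgen comp_rel (comp_act_gen s x) : comp).
Proof.
by rewrite addr0; have := pgr_gen cdeg comp_rel (comp_act_gen s x); case: x.
Qed.
Definition comp_act (s : 'S_N) : gmap 0 comp comp :=
  gplift comp_rel_homog (comp_act_gen_gr s).

Definition comp_diff_gen (x : cgen) : comp :=
  pgen comp_rel (CGen (hmap (sdiff C (car x)) (cop x)) (cin x) (clab_bij x))
  + \sum_(i < car x)
      koszul (-1) (hdeg (cop x) + \sum_(j < car x | (j < i)%N) hdeg (cin x j))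
      *: pgen comp_rel
           (CGen (cop x) (upd (cin x) i (hmap (sdiff D (cin_ar x i)) (cin x i)))
                 (clab_bij x)).
Lemma comp_diff_gen_gr x : gr (cdeg x + -1) (comp_diff_gen x).
Proof.
apply: grD.
  by have := pgr_gen cdeg comp_rel
    (CGen (hmap (sdiff C (car x)) (cop x)) (cin x) (clab_bij x));
    rewrite /cdeg /= addrAC.
apply: gr_sum => i _; apply: grZ.
set y := CGen _ _ _; have -> : cdeg x + -1 = cdeg y; last exact: pgr_gen.
rewrite /cdeg -addrA; congr (_ + _); rewrite (bigD1 i) // [RHS](bigD1 i) //=.
rewrite /upd dfwith_in /= addrAC; congr (_ + _).
by apply: eq_bigr => j ji; rewrite dfwith_out // eq_sym.
Qed.
Definition comp_diff : gmap (-1) comp comp := gplift comp_rel_homog comp_diff_gen_gr.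
End Composite.

Section Substitution.
Variables (C D : symseq) (N : nat) (A : gmod) (a : 'I_N -> hel A).

Definition subst_sign (x : cgen C D N) : k :=
  (\prod_(i < car x) \prod_(j < car x | (i < j)%N)
     koszul (hdeg (cin x j)) (\sum_l hdeg (a (clab x i l)))) *
  (\prod_(p : {i : 'I_(car x) & 'I_(cin_ar x i)})
   \prod_(q : {i : 'I_(car x) & 'I_(cin_ar x i)} |
     ((tag p < tag q) || ((tag p == tag q) && (tagged p < tagged q)))%N
       && (clab x _ (tagged q) < clab x _ (tagged p))%N)
     koszul (hdeg (a (clab x _ (tagged p)))) (hdeg (a (clab x _ (tagged q))))).

Definition subst_gen (x : cgen C D N) : schur C (schur D A) :=
  subst_sign x *: hval (schur_gen (SGen (cop x) (fun i =>
    schur_gen (SGen (cin x i) (fun j => a (clab x i j)))))).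

Lemma subst_gen_gr x : gr (cdeg x + tdeg a) (subst_gen x).
Proof.
apply: grZ; set y := SGen _ _; have -> : cdeg x + tdeg a = sdeg y; last exact: (helP (schur_gen y)).
rewrite /cdeg /sdeg -addrA; congr (_ + _).
rewrite /tdeg /= /sdeg /= big_split /=; congr (_ + _).
by rewrite sig_big_dep /= (reindex _ (onW_bij _ (clab_bij x))).
Qed.
Definition subst : gmap (tdeg a) (comp C D N) (schur C (schur D A)) :=
  gplift (@comp_rel_homog C D N) subst_gen_gr.
End Substitution.

Section Comonad.
Variable C : symseq.
Variable delta : forall n, gmap 0 (C n) (comp C C n).
Variable eps : {linear C 1%N -> k^o}.

Definition comult_gen (A : gmod) (x : sgen C A) : schur C (schur C A) :=
  subst C C (sarg x) (delta (sar x) (hval (sop x))).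
Lemma comult_gen_gr (A : gmod) (x : sgen C A) : gr (sdeg x + 0) (comult_gen x).
Proof.
rewrite addr0 /sdeg; apply: gfunP; rewrite -[hdeg _]addr0; apply: gfunP; exact: helP.
Qed.
Definition comult (A : gmod) : gmap 0 (schur C A) (schur C (schur C A)) :=
  gplift (@schur_rel_homog C A) (@comult_gen_gr A).

Hypothesis eps_deg : forall m (x : C 1%N), gr m x -> m != 0 -> eps x = 0.

Definition counit_gen (A : gmod) (x : sgen C A) : A :=
  match x with
  | @SGen _ _ n c a =>
    match n as n return hel (C n) -> ('I_n -> hel A) -> A with
    | 1 => fun c a => eps (hval c) *: hval (a ord0)
    | _ => fun _ _ => 0
    end c a
  end.
Lemma counit_gen_gr (A : gmod) (x : sgen C A) : gr (sdeg x + 0) (counit_gen x).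
Proof.
case: x => -[|[|n]] c a /=; try exact: gr0.
rewrite addr0 /sdeg /= /tdeg big_ord1.
have [c0|c0] := eqVneq (hdeg c) 0; first by rewrite c0 add0r; apply/grZ/helP.
by rewrite (eps_deg (helP c) c0) scale0r; exact: gr0.
Qed.
Definition counit (A : gmod) : gmap 0 (schur C A) A :=
  gplift (@schur_rel_homog C A) (@counit_gen_gr A).
End Comonad.

Record cooperad := Cooperad {
  coseq :> symseq;
  codelta : forall n, gmap 0 (coseq n) (comp coseq coseq n);
  coeps : {linear coseq 1%N -> k^o};
  coeps_deg : forall m (x : coseq 1%N), gr m x -> m != 0 -> coeps x = 0;
  codelta_act : forall n (s : 'S_n) x,
    codelta n (sact coseq s x) = comp_act _ _ s (codelta n x);
  codelta_diff : forall n x,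
    codelta n (sdiff coseq n x) = comp_diff _ _ n (codelta n x);
  coeps_diff : forall x, coeps (sdiff coseq 1 x) = 0;
  coassoc : forall (A : gmod) (x : schur coseq A),
    schur_map coseq (comult codelta A) (comult codelta A x)
    = comult codelta (schur coseq A) (comult codelta A x);
  counitl : forall (A : gmod) (x : schur coseq A),
    counit coeps_deg (schur coseq A) (comult codelta A x) = x;
  counitr : forall (A : gmod) (x : schur coseq A),
    schur_map coseq (counit coeps_deg A) (comult codelta A x) = x
}.

Definition is_coalgebra (C : cooperad) (A : gmod) (d : gmap (-1) A A)
    (Delta : gmap 0 A (schur C A)) : Prop :=
  [/\ forall x, d (d x) = 0,
      forall x, Delta (d x) = schur_diff C d (Delta x),
      forall x, schur_map C Delta (Delta x) = comult (codelta C) A (Delta x) &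
      forall x, counit (@coeps_deg C) A (Delta x) = x].

Definition thick_bd r A B (dA : gmap (-1) A A) (dB : gmap (-1) B B)
    (f : thick r A B) n (x : tpow A n) : tpow B n :=
  tdiff dB n (f n x) - koszul r 1 *: f n (tdiff dA n x).

Definition is_morphism r A B (f : thick r A B) : Prop :=
  forall p q x, f (p + q)%N x = tens (f p) (f q) x.

Definition is_pseudo_derivation A (h : thick 1 A A) : Prop :=
  forall p q (x : tpow A (p + q)),
    let dh y := tens (h p) (tone A q) y - tens (tone A p) (h q) y in
    dh (h (p + q)%N x) = tens (h p) (h q) x /\
    h (p + q)%N (dh x) = - tens (h p) (h q) x.

Definition is_coalgebra_thick (C : symseq) r A B (DA : gmap 0 A (schur C A))
    (DB : gmap 0 B (schur C B)) (f : thick r A B) : Prop :=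
  symmetric_thick f /\
  forall x : tpow A 1, DB (tout B (f 1%N x)) = schur_thick C f (DA (tout A x)).

Definition is_coderivation (C : symseq) r A (DA : gmap 0 A (schur C A))
    (t : thick r A A) : Prop :=
  is_coalgebra_thick DA DA t /\
  forall p q x, t (p + q)%N x = tens (t p) (tone A q) x + tens (tone A p) (t q) x.

Definition is_perturbation (C : symseq) A (d : gmap (-1) A A)
    (DA : gmap 0 A (schur C A)) (t : thick (-1) A A) : Prop :=
  is_coderivation DA t /\
  forall n x, thick_bd d d t x + t n (t n x) = 0.

Record is_contraction (C : symseq) (A B : gmod)
    (dA : gmap (-1) A A) (DA : gmap 0 A (schur C A))
    (dB : gmap (-1) B B) (DB : gmap 0 B (schur C B))
    (f : thick 0 A B) (g : thick 0 B A) (h : thick 1 A A) : Prop := IsContraction {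
  contr_f : is_coalgebra_thick DA DB f;
  contr_g : is_coalgebra_thick DB DA g;
  contr_h : is_coalgebra_thick DA DA h;
  contr_df : forall n (x : tpow A n), thick_bd dA dB f x = 0;
  contr_dg : forall n (x : tpow B n), thick_bd dB dA g x = 0;
  contr_dh : forall n (x : tpow A n), thick_bd dA dA h x = g n (f n x) - x;
  contr_fg : forall n x, f n (g n x) = x;
  contr_fh : forall n x, f n (h n x) = 0;
  contr_hh : forall n x, h n (h n x) = 0;
  contr_hg : forall n x, h n (g n x) = 0;
  contr_fmor : is_morphism f;
  contr_gmor : is_morphism g;
  contr_hpd : is_pseudo_derivation h
}.

Definition thick_invertible A (u : forall n, tpow A n -> tpow A n) : Prop :=
  exists v : thick 0 A A, forall n x, v n (u n x) = x /\ u n (v n x) = x.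

Definition is_perturbation_series A B (f : thick 0 A B) (g : thick 0 B A)
    (h : thick 1 A A) (t : thick (-1) A A)
    (f' : thick 0 A B) (g' : thick 0 B A) (h' : thick 1 A A) (t' : thick (-1) B B) : Prop :=
  [/\ forall n x, f' n x = f n x + f' n (t n (h n x)),
      forall n x, g' n x = g n x + h n (t n (g' n x)),
      forall n x, h' n x = h n x + h' n (t n (h n x)) &
      forall n x, t' n x = f n (t n (g' n x))].

End Graded.
Arguments gr {k g} _ _ : simpl never.
Arguments gcar : simpl never.
Arguments pgmod : simpl never.
Arguments tpow : simpl never.
Arguments sarg {k C A} s _.
Arguments cin_ar {k C D N} c _.
Arguments cin {k C D N} c i.
Arguments clab {k C D N} c i _.

(* Main.v *)
From mathcomp Require Import all_boot all_algebra perm fingroup.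
From mathcomp Require Import boolp ring zify.
Require Import Defs.
Set Implicit Arguments.
Unset Strict Implicit.
Unset Printing Implicit Defensive.
Import GRing.Theory.
Local Open Scope ring_scope.

(** Write [u = (1 - th)^-1], [v = (1 - ht)^-1] and [s = tv = ut].  Then [f' = fu],
    [g' = vg], [h' = vh = hu], [t' = fsg], and levelwise everything follows from
    [(d + t)v - vd = v g f s] and [u(d + t) - du = s g f u].

    For the multiplicative conditions, work on [A^(p+q)] with [X = h_p (x) 1],
    [Y = 1 (x) h_q], [H = h_(p+q)], [a = t_p (x) 1], [b = 1 (x) t_q], so that
    [t_(p+q) = a + b].  Factoring [(1 - Xa)^-1 (1 - Yb)^-1] out of [X' - Y'] carries
    [(X - Y)H = XY] over to [(X' - Y')H' = X'Y'].  Differentiating the two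
    pseudo-derivation identities gives, with [E1 = gf (x) 1] and [E2 = 1 (x) gf],
    [E1 H = E1 Y], [E2 H = E2 X], [H E1 = Y E1], [H E2 = X E2]; these are what
    makes [f'] and [g'] multiplicative.

    Compatibility with the structure maps is closed under sums, composites and
    inverses because [C[-]] is functorial and additive on symmetric thick maps;
    and since [t] is a derivation, the differential induced on [A^n] by
    [d_A + t_1] is [d + t_n]. *)

(** * Abelian group identities by reflection *)

Inductive zexpr := ZVar of nat | ZZero | ZAdd of zexpr & zexpr | ZOpp of zexpr.

Fixpoint zeval (V : zmodType) (env : seq V) (e : zexpr) : V :=
  match e with
  | ZVar i => nth 0 env i
  | ZZero => 0
  | ZAdd e1 e2 => zeval env e1 + zeval env e2
  | ZOpp e1 => - zeval env e1
  end.

Fixpoint zcoef (e : zexpr) (i : nat) : int :=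
  match e with
  | ZVar j => (i == j)%:Z
  | ZZero => 0
  | ZAdd e1 e2 => zcoef e1 i + zcoef e2 i
  | ZOpp e1 => - zcoef e1 i
  end.

(** Only the integer coefficients at the listed atoms matter, so an identity valid in every abelian
    group reduces to finitely many comparisons of integers, settled by computation. *)
Lemma zevalE (V : zmodType) (env : seq V) e :
  zeval env e = \sum_(i < size env) nth 0 env i *~ zcoef e i.
Proof.
elim: e => [j||e1 IH1 e2 IH2|e1 IH1] /=.
- have [ltj|gej] := ltnP j (size env); last first.
    (* An index past the end reads the default 0, and no summand has a nonzero coefficient. *)
    rewrite nth_default // big1 // => i _.
    by rewrite (negbTE (_ : i != j :> nat)) // neq_ltn (leq_trans (ltn_ord i)).
  rewrite (bigD1 (Ordinal ltj)) //= eqxx big1 ?addr0 // => i /negbTE ij.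
  by rewrite -[_ == _]/(i == Ordinal ltj) ij.
- by rewrite big1.
- by rewrite IH1 IH2 -big_split; apply: eq_bigr => i _; rewrite mulrzDr.
- by rewrite IH1 -sumrN; apply: eq_bigr => i _; rewrite mulrNz.
Qed.

Lemma zeval_eq (V : zmodType) (env : seq V) e1 e2 :
  all (fun i => zcoef e1 i == zcoef e2 i) (iota 0 (size env)) ->
  zeval env e1 = zeval env e2.
Proof.
move=> /allP eq12; rewrite !zevalE; apply: eq_bigr => i _.
by rewrite (eqP (eq12 _ _)) // mem_iota ltn_ord.
Qed.

Ltac zindex x env :=
  lazymatch env with
  | x :: _ => constr:(0%N)
  | _ :: ?env' => let i := zindex x env' in constr:(i.+1)
  end.

Ltac zinsert x env :=
  lazymatch env with
  | nil => constr:(x :: env)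
  | x :: _ => env
  | ?y :: ?env' => let env'' := zinsert x env' in constr:(y :: env'')
  end.

Ltac zatoms e env :=
  lazymatch e with
  | @GRing.add _ ?x ?y => let env' := zatoms x env in zatoms y env'
  | @GRing.opp _ ?x => zatoms x env
  | @GRing.zero _ => env
  | _ => zinsert e env
  end.

Ltac zreify e env :=
  lazymatch e with
  | @GRing.add _ ?x ?y =>
      let a := zreify x env in let b := zreify y env in constr:(ZAdd a b)
  | @GRing.opp _ ?x => let a := zreify x env in constr:(ZOpp a)
  | @GRing.zero _ => constr:(ZZero)
  | _ => let i := zindex e env in constr:(ZVar i)
  end.

Ltac zmod :=
  lazymatch goal with
  | |- @eq ?V ?x ?y =>
      let env := zatoms x (@nil V) in
      let env := zatoms y env in
      let e1 := zreify x env in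
      let e2 := zreify y env in
      apply: (@zeval_eq _ env e1 e2); vm_compute; reflexivity
  end.

(** * Tensor products of graded maps *)

Section Koszul.
Variable k : comPzRingType.
Implicit Types (m n : int).

Lemma koszulDr m n n' : koszul k m (n + n') = koszul k m n * koszul k m n'.
Proof.
rewrite /koszul; have -> : odd `|(n + n')%R|%N = odd `|n|%N (+) odd `|n'|%N by lia.
by case: odd; case: odd; case: odd; rewrite ?mulr1 ?mul1r //= expr1 mulrNN mulr1.
Qed.

Lemma koszulC m n : koszul k m n = koszul k n m.
Proof. by rewrite /koszul andbC. Qed.

Lemma koszulDl m m' n : koszul k (m + m') n = koszul k m n * koszul k m' n.
Proof. by rewrite !(koszulC _ n) koszulDr. Qed.

Lemma koszul0l n : koszul k 0 n = 1.
Proof. by []. Qed.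

Lemma koszul0r n : koszul k n 0 = 1.
Proof. by rewrite koszulC. Qed.

Lemma koszulK m n : koszul k m n * koszul k m n = 1.
Proof.
by rewrite /koszul; case: (_ && _); rewrite ?expr0 ?expr1 ?mulrNN mulr1.
Qed.

Lemma koszul_sum I (r : seq I) (P : pred I) m (F : I -> int) :
  koszul k m (\sum_(i <- r | P i) F i) = \prod_(i <- r | P i) koszul k m (F i).
Proof.
by apply: (big_morph (koszul k m)) => [n n'|]; rewrite (koszulDr, koszul0r).
Qed.
End Koszul.

Section GradedMaps.
Variables (k : comPzRingType) (A B C : gmod k).

Lemma gmap0 r (f : gmap r A B) : f 0 = 0.
Proof. exact: linear0. Qed.

Lemma gmapP r (f : gmap r A B) c x y : f (c *: x + y) = c *: f x + f y.
Proof. exact: linearP. Qed.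

Lemma gmapZ r (f : gmap r A B) c x : f (c *: x) = c *: f x.
Proof. exact: linearZ. Qed.

Lemma gmapD r (f : gmap r A B) x y : f (x + y) = f x + f y.
Proof. exact: linearD. Qed.

Lemma gmapB r (f : gmap r A B) x y : f (x - y) = f x - f y.
Proof. exact: linearB. Qed.

Lemma gmapN r (f : gmap r A B) x : f (- x) = - f x.
Proof. exact: linearN. Qed.

Lemma gmap_sum r (f : gmap r A B) I (s : seq I) (P : pred I) (F : I -> A) :
  f (\sum_(i <- s | P i) F i) = \sum_(i <- s | P i) f (F i).
Proof. exact: linear_sum. Qed.

(** The degree [q] is tied to [r + s] by an equation instead of being that sum: a composite of maps
    of degrees 1 and -1 then has type [gmap 0], with no transport along equalities of integers. *)
Lemma gcomp_homog r s q (e : r + s = q) (g : gmap s B C) (f : gmap r A B) m x :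
  gr m x -> gr (m + q) ((g \o f) x).
Proof. by move=> xm; rewrite -e addrA; do 2 apply: gfunP. Qed.
Definition gcomp r s q (e : r + s = q) (g : gmap s B C) (f : gmap r A B) :
  gmap q A C := GMap (gcomp_homog e g f).

Lemma gadd_homog r (f g : gmap r A B) m x : gr m x -> gr (m + r) ((f \+ g) x).
Proof. by move=> xm; apply: grD; apply: gfunP. Qed.
Definition gadd r (f g : gmap r A B) : gmap r A B := GMap (gadd_homog f g).

Lemma gsub_homog r (f g : gmap r A B) m x : gr m x -> gr (m + r) ((f \- g) x).
Proof.
move=> xm; apply: grD; first exact: gfunP.
by rewrite -scaleN1r; apply/grZ/gfunP.
Qed.
Definition gsub r (f g : gmap r A B) : gmap r A B := GMap (gsub_homog f g).
End GradedMaps.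

Section Tensors.
Variable k : comPzRingType.
Implicit Types (A B C : gmod k).

(** Generators of [tpow] are families of homogeneous elements, so linearity in a slot can only be
    tested on elements of one degree. *)
Definition multilinear A n (V : lmodType k) (phi : ('I_n -> hel A) -> V) : Prop :=
  forall a i c (x x1 x2 : hel A), hdeg x1 = hdeg x -> hdeg x2 = hdeg x ->
    hval x = c *: hval x1 + hval x2 ->
    phi (upd a i x) = c *: phi (upd a i x1) + phi (upd a i x2).

(** Read from right to left it checks that a map respects a relation; read from left to right, with
    [respects_pgen], it turns a relation into an equation between generators. *)
Lemma feval_linrel (V : lmodType k) X (phi : X -> V) c x x1 x2 :
  feval phi [:: (1, x); (- c, x1); (-1, x2)] = 0 <->
  phi x = c *: phi x1 + phi x2.
Proof.
rewrite /feval !big_cons big_nil /= addr0 scale1r scaleNr scaleN1r -opprD.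
by split=> [/subr0_eq //|->]; rewrite subrr.
Qed.

Lemma feval_eqrel (V : lmodType k) X (phi : X -> V) c x y :
  feval phi [:: (1, x); (- c, y)] = 0 <-> phi x = c *: phi y.
Proof.
rewrite /feval !big_cons big_nil /= addr0 scale1r scaleNr.
by split=> [/subr0_eq //|->]; rewrite subrr.
Qed.

Lemma multilinear_respects A n (V : lmodType k) (phi : ('I_n -> hel A) -> V) :
  multilinear phi -> respects (@tensor_rel k A n) phi.
Proof.
by move=> phiP s [a i c x x1 x2 e1 e2 e]; apply/feval_linrel/phiP.
Qed.

Lemma tgen_multilinear A n : multilinear (@tgen k A n).
Proof.
move=> a i c x x1 x2 e1 e2 e; apply/feval_linrel.
exact/(respects_pgen (TensorRel a i e1 e2 e)).
Qed.

Lemma tpow_ind A n (Q : tpow A n -> Prop) :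
  Q 0 -> (forall c a x, Q x -> Q (c *: tgen a + x)) -> forall x, Q x.
Proof.
move=> Q0 QP x; rewrite (prep_sum x).
by elim: (prep x) => [|[c a] s IH]; rewrite ?big_nil ?big_cons //; apply: QP.
Qed.

(** A homogeneous element has a representative whose terms all have its degree. This lets [tens_cat]
    attach a single Koszul sign to any homogeneous left factor. *)
Lemma tpow_gr_ind A n m (Q : tpow A n -> Prop) :
  Q 0 -> (forall c a x, tdeg a = m -> Q x -> Q (c *: tgen a + x)) ->
  forall x : tpow A n, gr m x -> Q x.
Proof.
move=> Q0 QP x [s sm ->]; rewrite pcls_sum.
elim: s sm => [|[c a] s IH] /=; first by rewrite big_nil.
by case/andP=> /eqP am /IH Qs; rewrite big_cons; apply: QP.
Qed.

Lemma upd_in A n (a : 'I_n -> hel A) i x : upd a i x i = x.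
Proof. exact: dfwith_in. Qed.

Lemma upd_out A n (a : 'I_n -> hel A) i j x : i != j -> upd a i x j = a j.
Proof. exact: dfwith_out. Qed.

Lemma acat_lshift T p q (a : 'I_p -> T) (b : 'I_q -> T) i :
  acat a b (lshift q i) = a i.
Proof. by rewrite /acat (unsplitK (inl i)). Qed.

Lemma acat_rshift T p q (a : 'I_p -> T) (b : 'I_q -> T) i :
  acat a b (rshift p i) = b i.
Proof. by rewrite /acat (unsplitK (inr i)). Qed.

Lemma acat_eta T p q (a : 'I_(p + q) -> T) :
  acat (fun i => a (lshift q i)) (fun i => a (rshift p i)) = a.
Proof.
by apply/funext => i; rewrite -(splitK i); case: split => j /=;
  rewrite (acat_lshift, acat_rshift).
Qed.

Lemma acat_updl A p q (a : 'I_p -> hel A) (b : 'I_q -> hel A) i x :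
  acat (upd a i x) b = upd (acat a b) (lshift q i) x.
Proof.
apply/funext => j; rewrite -(splitK j); case: split => {}j /=.
  rewrite acat_lshift; have [<-|ij] := eqVneq i j; first by rewrite !upd_in.
  by rewrite !upd_out ?acat_lshift // eq_lshift.
by rewrite acat_rshift upd_out ?acat_rshift // eq_lrshift.
Qed.

Lemma acat_updr A p q (a : 'I_p -> hel A) (b : 'I_q -> hel A) i x :
  acat a (upd b i x) = upd (acat a b) (rshift p i) x.
Proof.
apply/funext => j; rewrite -(splitK j); case: split => {}j /=; last first.
  rewrite acat_rshift; have [<-|ij] := eqVneq i j; first by rewrite !upd_in.
  by rewrite !upd_out ?acat_rshift // eq_rshift.
by rewrite acat_lshift upd_out ?acat_lshift // eq_rlshift.
Qed.

Lemma tgen_acat_respects A p q (a : 'I_p -> hel A) :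
  respects (@tensor_rel k A q) (fun b => tgen (acat a b)).
Proof.
apply: multilinear_respects => b i c x x1 x2 e1 e2 e.
by rewrite !acat_updr; apply: tgen_multilinear.
Qed.

Lemma tcat_respects A p q (y : tpow A q) :
  respects (@tensor_rel k A p)
    (fun a => plift (@tensor_rel k A q) (fun b => tgen (acat a b)) y).
Proof.
apply: multilinear_respects => a i c x x1 x2 e1 e2 e.
rewrite !pliftE; try exact: tgen_acat_respects.
rewrite /feval scaler_sumr -big_split; apply: eq_bigr => -[c' b] _ /=.
by rewrite !acat_updl (tgen_multilinear _ _ e1 e2 e) scalerDr scalerA mulrC -scalerA.
Qed.

Lemma tcatPl A p q c (x x' : tpow A p) (y : tpow A q) :
  tcat (c *: x + x') y = c *: tcat x y + tcat x' y.
Proof. by rewrite /tcat linearP. Qed.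

Lemma tcat0l A p q (y : tpow A q) : tcat (0 : tpow A p) y = 0.
Proof. exact: linear0. Qed.

(** The outer [plift] of [tcat] gives linearity in [x] only; for [y], take a representative of [x]
    and use the inner [plift] term by term. *)
Lemma tcatPr A p q c (x : tpow A p) (y y' : tpow A q) :
  tcat x (c *: y + y') = c *: tcat x y + tcat x y'.
Proof.
rewrite /tcat !pliftE; try exact: tcat_respects.
rewrite /feval scaler_sumr -big_split; apply: eq_bigr => -[c' a] _ /=.
by rewrite linearP scalerDr scalerA mulrC -scalerA.
Qed.

Lemma tcat0r A p q (x : tpow A p) : tcat x (0 : tpow A q) = 0.
Proof.
by have := tcatPr 1 x (0 : tpow A q) 0; rewrite !scale1r addr0 => /esym/eqP;
  rewrite -subr_eq0 addrK => /eqP.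
Qed.

Lemma tcat_gen A p q (a : 'I_p -> hel A) (b : 'I_q -> hel A) :
  tcat (tgen a) (tgen b) = tgen (acat a b).
Proof.
by rewrite /tcat plift_gen ?plift_gen //;
  [exact: tgen_acat_respects | exact: tcat_respects].
Qed.

(** An update within one degree leaves the degree of the left block, and hence the Koszul sign,
    unchanged; the rest is bilinearity of [tcat]. *)
Lemma tens_respects A B r s p q (f : gmap r (tpow A p) (tpow B p))
    (g : gmap s (tpow A q) (tpow B q)) :
  respects (@tensor_rel k A (p + q)) (tens_gen f g).
Proof.
have genE a b : tens_gen f g (acat a b) =
    koszul k s (tdeg a) *: tcat (f (tgen a)) (g (tgen b)).
  rewrite /tens_gen; congr (koszul _ _ (tdeg _) *: tcat (f (tgen _)) (g (tgen _)));
    by apply/funext => i; rewrite (acat_lshift, acat_rshift).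
apply: multilinear_respects => a i c x x1 x2 e1 e2 e.
rewrite -(acat_eta a) -(splitK i); case: split => {}i /=.
  rewrite -!acat_updl !genE (tdeg_upd _ _ e1) (tdeg_upd _ _ e2).
  rewrite (tgen_multilinear _ _ e1 e2 e) gmapP tcatPl.
  by rewrite scalerDr !scalerA mulrC.
rewrite -!acat_updr !genE (tgen_multilinear _ _ e1 e2 e) gmapP tcatPr.
by rewrite scalerDr !scalerA mulrC.
Qed.

Lemma tens_gen_cat A B r s p q (f : gmap r (tpow A p) (tpow B p))
    (g : gmap s (tpow A q) (tpow B q)) a b :
  tens f g (tcat (tgen a) (tgen b)) =
  koszul k s (tdeg a) *: tcat (f (tgen a)) (g (tgen b)).
Proof.
rewrite tcat_gen [LHS]plift_gen; last exact: tens_respects.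
rewrite /tens_gen; congr (koszul _ _ (tdeg _) *: tcat (f (tgen _)) (g (tgen _)));
  by apply/funext => i; rewrite (acat_lshift, acat_rshift).
Qed.

Lemma tens_cat A B r s p q (f : gmap r (tpow A p) (tpow B p))
    (g : gmap s (tpow A q) (tpow B q)) m (x : tpow A p) (y : tpow A q) :
  gr m x -> tens f g (tcat x y) = koszul k s m *: tcat (f x) (g y).
Proof.
move: x; apply: tpow_gr_ind => [|c a x <- IH].
  by rewrite tcat0l !gmap0 tcat0l scaler0.
rewrite tcatPl !gmapP IH tcatPl scalerDr !scalerA [_ * c]mulrC -scalerA.
congr (_ *: _ + _); elim/tpow_ind: y {IH} => [|c' b y IH].
  by rewrite tcat0r !gmap0 tcat0r scaler0.
rewrite tcatPr !gmapP IH tens_gen_cat tcatPr scalerDr !scalerA; congr (_ *: _ + _).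
exact: mulrC.
Qed.

Lemma tpow_cat_ind A p q (Q : tpow A (p + q) -> Prop) :
  Q 0 ->
  (forall c a b x, Q x -> Q (c *: tcat (tgen a) (tgen b) + x)) ->
  forall x, Q x.
Proof.
move=> Q0 QP; apply: tpow_ind => // c a x.
by rewrite -(acat_eta a) -tcat_gen; apply: QP.
Qed.

(** The interchange law: the sign comes from moving [g] past [f']. The composites enter as maps
    [f''] and [g''] known pointwise, so that any map equal to a composite, such as an identity, can
    be substituted. *)
Lemma tens_comp A B C r s r' s' r'' s'' p q
    (f : gmap r (tpow B p) (tpow C p)) (g : gmap s (tpow B q) (tpow C q))
    (f' : gmap r' (tpow A p) (tpow B p)) (g' : gmap s' (tpow A q) (tpow B q))
    (f'' : gmap r'' (tpow A p) (tpow C p)) (g'' : gmap s'' (tpow A q) (tpow C q)) :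
  s + s' = s'' -> f \o f' =1 f'' -> g \o g' =1 g'' ->
  forall x, tens f g (tens f' g' x) = koszul k s r' *: tens f'' g'' x.
Proof.
move=> Es Ef Eg; elim/tpow_cat_ind => [|c a b x IH].
  by rewrite !gmap0 scaler0.
rewrite !gmapP IH scalerDr scalerA mulrC -scalerA; congr (_ *: _ + _).
rewrite !tens_gen_cat gmapZ (tens_cat _ _ _ (gfunP f' (tgen_gr a))).
rewrite -Ef -Eg /= !scalerA; congr (_ *: _).
by rewrite -Es koszulDr koszulDl; ring.
Qed.

Lemma tensPl A B r s p q c (f f1 f2 : gmap r (tpow A p) (tpow B p))
    (g : gmap s (tpow A q) (tpow B q)) :
  (forall x, f x = c *: f1 x + f2 x) ->
  forall x, tens f g x = c *: tens f1 g x + tens f2 g x.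
Proof.
move=> Ef; elim/tpow_cat_ind => [|c' a b x IH].
  by rewrite !gmap0 scaler0 addr0.
rewrite !gmapP IH !tens_gen_cat Ef tcatPl !scalerDr !scalerA addrACA.
by congr (_ *: _ + _ + _); ring.
Qed.

Lemma tensPr A B r s p q c (f : gmap r (tpow A p) (tpow B p))
    (g g1 g2 : gmap s (tpow A q) (tpow B q)) :
  (forall x, g x = c *: g1 x + g2 x) ->
  forall x, tens f g x = c *: tens f g1 x + tens f g2 x.
Proof.
move=> Eg; elim/tpow_cat_ind => [|c' a b x IH].
  by rewrite !gmap0 scaler0 addr0.
rewrite !gmapP IH !tens_gen_cat Eg tcatPr !scalerDr !scalerA addrACA.
by congr (_ *: _ + _ + _); ring.
Qed.

Lemma tens1 A p q x : tens (tone A p) (tone A q) x = x.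
Proof.
elim/tpow_cat_ind: x => [|c a b x IH]; first by rewrite gmap0.
by rewrite gmapP IH tens_gen_cat koszul0l scale1r.
Qed.
End Tensors.

(** * The differential and the permutation action on tensor powers *)

Section TensorDifferential.
Variable k : comPzRingType.
Implicit Types (A B C : gmod k).

Lemma upd_id A n (a : 'I_n -> hel A) i x y : upd (upd a i x) i y = upd a i y.
Proof.
by apply/funext => j; have [<-|ij] := eqVneq i j; rewrite ?upd_in ?upd_out.
Qed.

Lemma updC A n (a : 'I_n -> hel A) i j x y : i != j ->
  upd (upd a i x) j y = upd (upd a j y) i x.
Proof.
move=> ij; apply/funext => l; have [<-|jl] := eqVneq j l.
  by rewrite upd_in upd_out // upd_in.
by rewrite upd_out //; have [<-|il] := eqVneq i l; rewrite ?upd_in // !upd_out.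
Qed.

Lemma tdiff_respects A (d : gmap (-1) A A) n :
  respects (@tensor_rel k A n) (tdiff_gen d (n := n)).
Proof.
apply: multilinear_respects => a i c x x1 x2 e1 e2 e.
have degE y (P : pred 'I_n) : hdeg y = hdeg x ->
    \sum_(l | P l) hdeg (upd a i y l) = \sum_(l | P l) hdeg (upd a i x l).
  move=> ey; apply: eq_bigr => l _.
  by have [<-|il] := eqVneq i l; rewrite ?upd_in // !upd_out.
rewrite /tdiff_gen scaler_sumr -big_split; apply: eq_bigr => j _ /=.
rewrite (degE x1) // (degE x2) // scalerA mulrC -scalerA -scalerDr; congr (_ *: _).
have [<-|ij] := eqVneq i j.
  rewrite !upd_in !upd_id; apply: tgen_multilinear; rewrite /= ?e1 ?e2 //.
  by rewrite e gmapP.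
rewrite !upd_out // !(updC _ _ _ ij); exact: tgen_multilinear.
Qed.

Lemma tdiff_tgen A (d : gmap (-1) A A) n (a : 'I_n -> hel A) :
  tdiff d n (tgen a) = tdiff_gen d a.
Proof. by apply: plift_gen; exact: tdiff_respects. Qed.

Lemma tcat_suml A p q I (r : seq I) (P : pred I) (F : I -> tpow A p)
    (y : tpow A q) :
  tcat (\sum_(i <- r | P i) F i) y = \sum_(i <- r | P i) tcat (F i) y.
Proof.
apply: (big_morph (@tcat k A p q ^~ y)); last exact: tcat0l.
by move=> x x'; rewrite -[x]scale1r tcatPl !scale1r.
Qed.

Lemma tcat_sumr A p q I (r : seq I) (P : pred I) (F : I -> tpow A q)
    (x : tpow A p) :
  tcat x (\sum_(i <- r | P i) F i) = \sum_(i <- r | P i) tcat x (F i).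
Proof.
apply: (big_morph (@tcat k A p q x)); last exact: tcat0r.
by move=> y y'; rewrite -[y]scale1r tcatPr !scale1r.
Qed.

Lemma tcatZl A p q c (x : tpow A p) (y : tpow A q) :
  tcat (c *: x) y = c *: tcat x y.
Proof. by rewrite -[c *: x]addr0 tcatPl tcat0l addr0. Qed.

Lemma tcatZr A p q c (x : tpow A p) (y : tpow A q) :
  tcat x (c *: y) = c *: tcat x y.
Proof. by rewrite -[c *: y]addr0 tcatPr tcat0r addr0. Qed.

(** The positions split into the two blocks. Those of the right block have the whole left block
    before them, which accounts for the Koszul sign of [1 (x) d]. *)
Lemma tdiff_tens A (d : gmap (-1) A A) p q x :
  tdiff d (p + q) x =
  tens (tdiff d p) (tone A q) x + tens (tone A p) (tdiff d q) x.
Proof.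
elim/tpow_cat_ind: x => [|c a b x IH]; first by rewrite !gmap0 addr0.
rewrite !gmapP IH addrACA -scalerDr; congr (_ *: _ + _).
rewrite tcat_gen tdiff_tgen -tcat_gen !tens_gen_cat koszul0l scale1r !tdiff_tgen.
rewrite /tdiff_gen big_split_ord tcat_suml tcat_sumr scaler_sumr.
congr (_ + _); apply: eq_bigr => i _.
  rewrite acat_lshift -acat_updl -tcat_gen tcatZl; congr (koszul _ _ _ *: _).
  (* No position of the right block precedes a position of the left one. *)
  rewrite big_split_ord /= [X in _ + X]big_pred0 ?addr0 => [|j]; last first.
    by apply/negbTE; rewrite -leqNgt /= ltnW // (leq_trans (ltn_ord i)) ?leq_addr.
  by apply: eq_bigr => j _; rewrite acat_lshift.
rewrite acat_rshift -acat_updr -tcat_gen tcatZr scalerA -koszulDr.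
congr (koszul _ _ _ *: _); rewrite big_split_ord /=; congr (_ + _).
  apply: eq_big => j; last by rewrite acat_lshift.
  by rewrite /= (leq_trans (ltn_ord j)) ?leq_addr.
by apply: eq_big => j; rewrite ?acat_rshift //= ltn_add2l.
Qed.

(* Changing the degree of the factor [s i] by -1 changes the sign exactly by the
   inversions of [s] that involve [i]. *)
Lemma perm_sign_shift n (s : 'S_n) (u v : 'I_n -> int) i :
  u (s i) = v (s i) + -1 -> (forall j, j != i -> u (s j) = v (s j)) ->
  perm_sign k s v * koszul k (-1) (\sum_(j < n | (j < i)%N) v (s j)) =
  koszul k (-1) (\sum_(l < n | (l < s i)%N) v l) * perm_sign k s u.
Proof.
move=> ui uj; pose K j := koszul k (-1) (v (s j)).
have signE : perm_sign k s u = perm_sign k s v *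
    ((\prod_(j < n | (i < j)%N && (s j < s i)%N) K j) *
     \prod_(j < n | (j < i)%N && (s i < s j)%N) K j).
  rewrite /perm_sign.
  (* The two conditional factors are trivial unless the inversion involves [i]; placing them at
     every inversion lets the double product split. *)
  transitivity (\prod_(i' < n) \prod_(j < n | (i' < j)%N && (s j < s i')%N)
     (koszul k (v (s i')) (v (s j)) *
      ((if i' == i then K j else 1) * (if j == i then K i' else 1)))).
    apply: eq_bigr => i' _; apply: eq_bigr => j /andP[ij _].
    have [ei|nei] := eqVneq i' i; have [ej|nej] := eqVneq j i.
    - by move: ij; rewrite ei ej ltnn.
    - by rewrite ei ui (uj j) // koszulDl mulr1.
    - by rewrite ej ui (uj i') // koszulDr mul1r [koszul k _ (-1)]koszulC.
    - by rewrite !uj // !mulr1.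
  under eq_bigr do rewrite !big_split /=; rewrite !big_split /=.
  congr (_ * (_ * _)).
    rewrite (bigD1 i) //= [X in _ * X]big1 ?mulr1 => [|i' /negbTE nei].
      by rewrite eqxx.
    by rewrite nei big1.
  rewrite [RHS]big_mkcond; apply: eq_bigr => i' _.
  rewrite big_mkcond (bigD1 i) //= eqxx [X in _ * X]big1 ?mulr1 // => j /negbTE nej.
  by rewrite nej if_same.
rewrite signE mulrCA; congr (_ * _); rewrite !koszul_sum.
rewrite [X in _ = X * _](reindex_inj (@perm_inj _ s)) /=.
rewrite !(big_mkcond (fun j : 'I_n => (_ < _)%N)) !(big_mkcond (fun j => _ && _)).
rewrite -!big_split; apply: eq_bigr => j _ /=.
(* Only a [j] with [i < j] and [s j < s i] contributes [K j] twice, and there it cancels; in the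
   other cases both sides have the same factor. *)
have KK : K j * K j = 1 by exact: koszulK.
have [->|nji] := eqVneq j i; first by rewrite !ltnn !mulr1.
have nsji : s j != s i by rewrite (inj_eq perm_inj).
rewrite -/(K j); case: (ltngtP j i) => [_|_|/val_inj/eqP]; last by rewrite (negbTE nji).
  case: (ltngtP (s j) (s i)) => [_|_|/val_inj/eqP] /=; rewrite ?mul1r ?mulr1 //.
  by rewrite (negbTE nsji).
case: (ltngtP (s j) (s i)) => [_|_|/val_inj/eqP] /=; rewrite ?mul1r ?mulr1 //.
Qed.

Lemma upd_perm A n (a : 'I_n -> hel A) (s : 'S_n) i x :
  upd (fun j => a (s j)) i x = (fun j => upd a (s i) x (s j)).
Proof.
apply/funext => j; have [<-|ij] := eqVneq i j; first by rewrite !upd_in.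
by rewrite !upd_out // (inj_eq perm_inj).
Qed.

Lemma tperm_respects A n (s : 'S_n) :
  respects (@tensor_rel k A n) (tperm_gen (A := A) s).
Proof.
apply: multilinear_respects => a i c x x1 x2 e1 e2 e; rewrite /tperm_gen.
have degE y : hdeg y = hdeg x ->
    (fun j => hdeg (upd a i y j)) = (fun j => hdeg (upd a i x j)).
  move=> ey; apply/funext => j.
  by have [<-|ij] := eqVneq i j; rewrite ?upd_in // !upd_out.
rewrite (degE x1) // (degE x2) // -(permKV s i) -!upd_perm.
rewrite (tgen_multilinear _ _ e1 e2 e) scalerDr !scalerA; congr (_ *: _ + _).
exact: mulrC.
Qed.

Lemma tperm_tgen A n (s : 'S_n) (a : 'I_n -> hel A) :
  tperm A s (tgen a) = perm_sign k s (fun i => hdeg (a i)) *: tgen (fun i => a (s i)).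
Proof. by apply: plift_gen; exact: tperm_respects. Qed.

(** Differentiating slot [i] after the permutation corresponds to differentiating slot [s i] before
    it; [perm_sign_shift] compares the signs. *)
Lemma tdiff_sym A (d : gmap (-1) A A) n (s : 'S_n) x :
  tdiff d n (tperm A s x) = tperm A s (tdiff d n x).
Proof.
elim/tpow_ind: x => [|c a x IH]; first by rewrite !gmap0.
rewrite !gmapP IH; congr (_ *: _ + _).
rewrite tperm_tgen gmapZ !tdiff_tgen /tdiff_gen scaler_sumr gmap_sum.
rewrite [RHS](reindex_inj (@perm_inj _ s)); apply: eq_bigr => i _.
rewrite gmapZ tperm_tgen !scalerA upd_perm; congr (_ *: _).
by apply: perm_sign_shift => [|j ji]; rewrite ?upd_in // upd_out // (inj_eq perm_inj) eq_sym.
Qed.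
End TensorDifferential.

(** * Derivations and the perturbed differential *)

Section FirstPower.
Variables (k : comPzRingType) (A : gmod k).

Lemma tin_hval (h : hel A) : tin A (hval h) = tgen (fun=> h).
Proof.
rewrite [LHS]hliftE // => c x x1 x2 e1 e2 e; rewrite /tin_gen.
(* On the one-element index set, a constant family is an update of any family at its only slot. *)
have updE y : (fun=> y) = upd (fun=> x : hel A) (ord0 : 'I_1) y.
  by apply/funext => i; rewrite (ord1 i) upd_in.
by rewrite (updE x) (updE x1) (updE x2); apply: tgen_multilinear.
Qed.

Lemma tout_tgen (a : 'I_1 -> hel A) : tout A (tgen a) = hval (a ord0).
Proof.
apply: plift_gen; apply: multilinear_respects => b i c x x1 x2 _ _ e.
by rewrite (ord1 i) !upd_in.
Qed.

Lemma toutK : cancel (tout A) (tin A).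
Proof.
elim/tpow_ind => [|c a x IH]; first by rewrite !gmap0.
rewrite !gmapP IH tout_tgen tin_hval; congr (_ *: tgen _ + _).
by apply/funext => i; rewrite (ord1 i).
Qed.

Lemma tinK : cancel (tin A) (tout A).
Proof.
move=> x; have [s ->] := hel_spanP x.
by rewrite !gmap_sum; apply: eq_bigr => h _; rewrite tin_hval tout_tgen.
Qed.

Lemma tdiff1 (d : gmap (-1) A A) x : tdiff d 1 x = tin A (d (tout A x)).
Proof.
elim/tpow_ind: x => [|c a x IH]; first by rewrite !gmap0.
rewrite !gmapP IH tdiff_tgen /tdiff_gen big_ord1 big_pred0 // koszul0r scale1r.
rewrite tout_tgen -[d (hval _)]/(hval (hmap d (a ord0))) tin_hval.
by congr (_ *: tgen _ + _); apply/funext => i; rewrite (ord1 i) upd_in.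
Qed.
End FirstPower.

Section Derivations.
Variables (k : comPzRingType) (A : gmod k).

Definition is_derivation r (t : thick r A A) : Prop :=
  forall p q x, t (p + q)%N x = tens (t p) (tone A q) x + tens (tone A p) (t q) x.

(** The empty tensor is a unit for [tcat], so on it the derivation rule at [0 + 0] reads
    [t 1 = t 1 + t 1]. *)
Lemma derivation_tpow0 r (t : thick r A A) x : is_derivation t -> t 0%N x = 0.
Proof.
move=> tD; elim/tpow_ind: x => [|c a x IH]; first by rewrite gmap0.
have acat0 (b b' : 'I_0 -> hel A) : tcat (tgen b) (tgen b') = tgen a.
  by rewrite tcat_gen; congr tgen; apply/funext => -[].
have tcat0 (y : tpow A 0) : tcat y (tgen a) = y /\ tcat (tgen a) y = y.
  elim/tpow_ind: y => [|c' b y [IH1 IH2]]; first by rewrite tcat0l tcat0r.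
  have -> : b = a by apply/funext => -[].
  by rewrite tcatPl tcatPr IH1 IH2 acat0.
have := tD 0%N 0%N (tcat (tgen a) (tgen a)); rewrite !tens_gen_cat.
rewrite koszul0l /tdeg big_ord0 koszul0r !scale1r (tcat0 _).1 (tcat0 _).2 (tcat0 _).1.
rewrite gmapP IH addr0 => e; have -> : t 0%N (tgen a) = 0; last exact: scaler0.
by apply: (addrI (t 0%N (tgen a))); rewrite addr0 [RHS]e.
Qed.

(** A derivation is determined by its first level. Both sides obey the Leibniz rule along [1 + n],
    they agree at level 1 by the definition of [pert_diff], and at level 0 everything vanishes. *)
Lemma tdiff_pert (d : gmap (-1) A A) (t : thick (-1) A A) n x :
  is_derivation t -> tdiff (pert_diff d t) n x = tdiff d n x + t n x.
Proof.
move=> tD; elim: n x => [|n IH] x.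
  rewrite (derivation_tpow0 _ tD) addr0; elim/tpow_ind: x => [|c a x IH].
    by rewrite !gmap0.
  by rewrite !gmapP IH !tdiff_tgen /tdiff_gen !big_ord0.
have step1 y : tdiff (pert_diff d t) 1 y = 1 *: tdiff d 1 y + t 1%N y.
  rewrite scale1r !tdiff1 -[pert_diff _ _ _]/(pert_fun _ _ _) /pert_fun toutK.
  by rewrite gmapD toutK.
have stepn y : tdiff (pert_diff d t) n y = 1 *: tdiff d n y + t n y.
  by rewrite scale1r.
rewrite -[n.+1]/(1 + n)%N in x *; rewrite !tdiff_tens tD.
by rewrite (tensPl _ step1) (tensPr _ stepn) !scale1r addrACA.
Qed.
End Derivations.

(** * Functoriality of the Schur construction *)

Section ThickMaps.
Variables (k : comPzRingType).
Implicit Types (A B D : gmod k).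

Definition tcomp A B D r s q (e : r + s = q) (g : thick s B D) (f : thick r A B) :
  thick q A D := fun n => gcomp e (g n) (f n).
Definition tadd A B r (f g : thick r A B) : thick r A B := fun n => gadd (f n) (g n).
Definition tsub A B r (f g : thick r A B) : thick r A B := fun n => gsub (f n) (g n).

Lemma tcomp_sym A B D r s q (e : r + s = q) (g : thick s B D) (f : thick r A B) :
  symmetric_thick g -> symmetric_thick f -> symmetric_thick (tcomp e g f).
Proof. by move=> gS fS n s' x; rewrite /= fS gS. Qed.

Lemma tadd_sym A B r (f g : thick r A B) :
  symmetric_thick f -> symmetric_thick g -> symmetric_thick (tadd f g).
Proof. by move=> fS gS n s x; rewrite /= fS gS -gmapD. Qed.

Lemma tsub_sym A B r (f g : thick r A B) :
  symmetric_thick f -> symmetric_thick g -> symmetric_thick (tsub f g).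
Proof. by move=> fS gS n s x; rewrite /= fS gS -gmapB. Qed.

Lemma inv_sym A (u v : thick 0 A A) :
  (forall n, cancel (u n) (v n)) -> (forall n, cancel (v n) (u n)) ->
  symmetric_thick u -> symmetric_thick v.
Proof. by move=> uK vK uS n s x; rewrite -{1}(vK n x) -uS uK. Qed.
End ThickMaps.

Section SchurFunctor.
Variables (k : comPzRingType) (C : symseq k).
Implicit Types (A B D : gmod k).

(** Phrasing the relations on whole tensor powers rather than on generators hides the permutation
    sign inside [tperm]; the relation in the arguments follows from linearity of [psi] and
    [tgen_multilinear]. *)
Lemma schur_respects A (V : lmodType k)
    (psi : forall n, hel (C n) -> tpow A n -> V) :
  (forall n h c x y, psi n h (c *: x + y) = c *: psi n h x + psi n h y) ->
  (forall n c h h1 h2 x, hdeg h1 = hdeg h -> hdeg h2 = hdeg h ->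
     hval h = c *: hval h1 + hval h2 ->
     psi n h x = c *: psi n h1 x + psi n h2 x) ->
  (forall n (s : 'S_n) h x, psi n (hmap (sact C s) h) (tperm A s x) = psi n h x) ->
  respects (@schur_rel k C A) (fun y => psi (sar y) (sop y) (tgen (sarg y))).
Proof.
move=> psiP psi_op psi_sym _ [n c h h1 h2 a e1 e2 e|n h a i c x x1 x2 e1 e2 e|n h a s].
- by apply/feval_linrel => /=; apply: psi_op.
- by apply/feval_linrel => /=; rewrite (tgen_multilinear _ _ e1 e2 e).
apply/feval_eqrel => /=; rewrite -(psi_sym n s) tperm_tgen.
have psi0 h' : psi n h' 0 = 0.
  by apply: (addrI (psi n h' 0)); rewrite addr0 -{1}[psi _ _ _]scale1r -psiP scale1r addr0.
by rewrite -[_ *: tgen _]addr0 psiP psi0 addr0.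
Qed.

Lemma schur_ind A (Q : schur C A -> Prop) :
  Q 0 -> (forall c y x, Q x -> Q (c *: hval (schur_gen y) + x)) -> forall x, Q x.
Proof.
move=> Q0 QP x; rewrite (prep_sum x).
by elim: (prep x) => [|[c y] s IH]; rewrite ?big_nil ?big_cons //; apply: QP.
Qed.

Lemma schur_ins_tgen A n (h : hel (C n)) (a : 'I_n -> hel A) :
  schur_ins A h (tgen a) = hval (schur_gen (SGen h a)).
Proof.
apply: plift_gen; apply: multilinear_respects => {}a i c x x1 x2 e1 e2 e.
by have /feval_linrel := respects_pgen (SchurArg h a i e1 e2 e).
Qed.

Lemma schur_ins_op A n c (h h1 h2 : hel (C n)) (x : tpow A n) :
  hdeg h1 = hdeg h -> hdeg h2 = hdeg h -> hval h = c *: hval h1 + hval h2 ->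
  schur_ins A h x = c *: schur_ins A h1 x + schur_ins A h2 x.
Proof.
move=> e1 e2 e; elim/tpow_ind: x => [|c' a x IH].
  by rewrite !gmap0 scaler0 addr0.
rewrite !gmapP IH !schur_ins_tgen !scalerDr addrACA !scalerA [c * _]mulrC.
rewrite -scalerA -scalerDr; congr (_ *: _ + _).
by have /feval_linrel := respects_pgen (SchurOp a e1 e2 e).
Qed.

(** Degrees of composites of [hmap] may agree only up to an equation of integers; the linearity
    relation with coefficient 0 identifies the generators anyway. *)
Lemma schur_ins_eq A n (h h1 : hel (C n)) (x : tpow A n) :
  hdeg h1 = hdeg h -> hval h1 = hval h -> schur_ins A h1 x = schur_ins A h x.
Proof.
by move=> e1 e; rewrite (@schur_ins_op A n 0 h h h1 x) // ?e ?scale0r ?add0r.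
Qed.

Lemma schur_ins_sym A n (s : 'S_n) (h : hel (C n)) (x : tpow A n) :
  schur_ins A (hmap (sact C s) h) (tperm A s x) = schur_ins A h x.
Proof.
elim/tpow_ind: x => [|c a x IH]; first by rewrite !gmap0.
rewrite !gmapP IH tperm_tgen gmapZ !schur_ins_tgen; congr (_ *: _ + _).
by have /feval_eqrel := respects_pgen (SchurSym h a s).
Qed.

Lemma schur_thick_respects A B r (f : thick r A B) :
  symmetric_thick f -> respects (@schur_rel k C A) (schur_thick_gen (C := C) f).
Proof.
move=> fS.
apply: (schur_respects (psi := fun n h x => koszul k r (hdeg h) *: schur_ins B h (f n x))).
- by move=> n h c x y; rewrite !gmapP scalerDr !scalerA mulrC.
- move=> n c h h1 h2 x e1 e2 e; rewrite (schur_ins_op _ e1 e2 e).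
  rewrite (congr1 (koszul k r) e1) (congr1 (koszul k r) e2).
  by rewrite scalerDr !scalerA mulrC.
by move=> n s h x; rewrite fS schur_ins_sym /= addr0.
Qed.

Lemma schur_thick_gen_ins A B r (f : thick r A B) n (h : hel (C n)) x :
  symmetric_thick f ->
  schur_thick C f (schur_ins A h x) = koszul k r (hdeg h) *: schur_ins B h (f n x).
Proof.
move=> fS; elim/tpow_ind: x => [|c a x IH]; first by rewrite !gmap0 scaler0.
rewrite !gmapP IH scalerDr !scalerA mulrC -scalerA schur_ins_tgen.
by rewrite [X in _ *: X + _]plift_gen //; exact: schur_thick_respects.
Qed.

Lemma schur_ins_ind A (Q : schur C A -> Prop) :
  Q 0 -> (forall c n (h : hel (C n)) y x, Q x -> Q (c *: schur_ins A h y + x)) ->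
  forall x, Q x.
Proof.
by move=> Q0 QP; apply: schur_ind => // c [n h a] x; rewrite -schur_ins_tgen; apply: QP.
Qed.

Lemma schur_thick_one A x : schur_thick C (tone A) x = x.
Proof.
elim/schur_ins_ind: x => [|c n h y x IH]; first by rewrite gmap0.
by rewrite gmapP IH schur_thick_gen_ins // scale1r.
Qed.

Lemma schur_thick_comp A B D r s q (f : thick r A B) (g : thick s B D)
    (gf : thick q A D) :
  r + s = q -> symmetric_thick f -> symmetric_thick g -> symmetric_thick gf ->
  (forall n, g n \o f n =1 gf n) ->
  forall x, schur_thick C g (schur_thick C f x) = schur_thick C gf x.
Proof.
move=> Eq fS gS gfS E; elim/schur_ins_ind => [|c n h y x IH]; first by rewrite !gmap0.
rewrite !gmapP IH !schur_thick_gen_ins // gmapZ schur_thick_gen_ins //.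
congr (_ *: _ + _).
by rewrite scalerA -koszulDl Eq -E.
Qed.

Lemma schur_thick_lin A B r c (f f1 f2 : thick r A B) :
  symmetric_thick f -> symmetric_thick f1 -> symmetric_thick f2 ->
  (forall n x, f n x = c *: f1 n x + f2 n x) ->
  forall x, schur_thick C f x = c *: schur_thick C f1 x + schur_thick C f2 x.
Proof.
move=> fS f1S f2S E; elim/schur_ins_ind => [|c' n h y x IH].
  by rewrite !gmap0 scaler0 addr0.
rewrite !gmapP IH !schur_thick_gen_ins // E gmapP !scalerDr !scalerA addrACA.
by congr (_ *: _ + _ + _); ring.
Qed.

Lemma schur_diff_respects A (d : gmap (-1) A A) :
  respects (@schur_rel k C A) (schur_diff_gen (C := C) d).
Proof.
pose psi n (h : hel (C n)) x := schur_ins A (hmap (sdiff C n) h) x +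
  koszul k (-1) (hdeg h) *: schur_ins A h (tdiff d n x).
have -> : schur_diff_gen (C := C) d =
    fun y => psi (sar y) (sop y) (tgen (sarg y)).
  by apply/funext => -[n h a]; rewrite /schur_diff_gen /psi /= schur_ins_tgen.
apply: schur_respects; rewrite /psi.
- move=> n h c x y; rewrite !gmapP !scalerDr !scalerA addrACA.
  by congr (_ + _ *: _ + _); rewrite mulrC.
- move=> n c h h1 h2 x e1 e2 e.
  rewrite (schur_ins_op _ e1 e2 e).
  rewrite (congr1 (koszul k (-1)) e1) (congr1 (koszul k (-1)) e2).
  rewrite (@schur_ins_op _ _ c _ (hmap (sdiff C n) h1) (hmap (sdiff C n) h2)) /=.
  + by rewrite !scalerDr !scalerA addrACA [c * _]mulrC.
  + by rewrite e1.
  + by rewrite e2.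
  + by rewrite e gmapP.
move=> n s h x; rewrite tdiff_sym schur_ins_sym [hdeg (hmap _ h)]addr0.
(* Acting and differentiating in the two orders gives the degrees [hdeg h + 0 + -1] and
   [hdeg h + -1 + 0]. *)
congr (_ + _); rewrite -[RHS](schur_ins_sym s); apply: schur_ins_eq => /=.
  by rewrite addr0 addrAC addr0.
by rewrite sdiff_act.
Qed.

Lemma schur_diff_ins A (d : gmap (-1) A A) n (h : hel (C n)) x :
  schur_diff C d (schur_ins A h x) = schur_ins A (hmap (sdiff C n) h) x +
    koszul k (-1) (hdeg h) *: schur_ins A h (tdiff d n x).
Proof.
elim/tpow_ind: x => [|c a x IH]; first by rewrite !gmap0 scaler0 addr0.
rewrite !gmapP IH !scalerDr addrACA !scalerA [_ * c]mulrC -scalerA -scalerDr.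
rewrite !schur_ins_tgen [X in _ *: X + _]plift_gen //.
exact: schur_diff_respects.
Qed.

(** The summand of [schur_diff] that differentiates the arguments carries the same sign as
    [schur_thick] in degree -1. This turns compatibility of [t] with the structure map into
    compatibility of the perturbed differential. *)
Lemma schur_diff_pert A (d : gmap (-1) A A) (t : thick (-1) A A) x :
  symmetric_thick t -> is_derivation t ->
  schur_diff C (pert_diff d t) x = schur_diff C d x + schur_thick C t x.
Proof.
move=> tS tD; elim/schur_ins_ind: x => [|c n h y x IH].
  by rewrite !gmap0 addr0.
rewrite !gmapP IH addrACA -scalerDr; congr (_ *: _ + _).
by rewrite !schur_diff_ins schur_thick_gen_ins // tdiff_pert // gmapD scalerDr addrA.
Qed.
End SchurFunctor.

(** * The perturbation lemma on a single level *)

Section PerturbationLemma.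
Variables (k : comPzRingType) (M N : gmod k) (dM t : gmap (-1) M M).
Variables (dN : gmap (-1) N N) (f : gmap 0 M N) (g : gmap 0 N M).
Variables (h : gmap 1 M M) (v : gmap 0 M M).
Hypothesis tP : forall x, dM (t x) + t (dM x) + t (t x) = 0.
Hypothesis fd : forall x, dN (f x) = f (dM x).
Hypothesis gd : forall y, dM (g y) = g (dN y).
Hypothesis hd : forall x, dM (h x) + h (dM x) = g (f x) - x.
Hypothesis fg : forall y, f (g y) = y.
Hypothesis fh : forall x, f (h x) = 0.
Hypothesis hh : forall x, h (h x) = 0.
Hypothesis hg : forall y, h (g y) = 0.
Hypothesis vl : forall x, v (x - h (t x)) = x.
Hypothesis vr : forall x, v x - h (t (v x)) = x.

Lemma pert_vE x : v x = x + h (t (v x)).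
Proof. by rewrite -{2}(vr x) subrK. Qed.

Lemma pert_vE' x : v x = x + v (h (t x)).
Proof. by rewrite -{2}(vl x) -gmapD subrK. Qed.

(** Cancel [v] and substitute [x = w - h (t w)] with [w = v x]; what is left is the homotopy
    relation at [t w] and the equation for [t] at [w]. *)
Lemma pert_dv x :
  dM (v x) + t (v x) = v (dM x) + v (g (f (t (v x)))).
Proof.
set w := v x; rewrite -[LHS]vl -[RHS]gmapD; congr (v _).
have -> : dM x = dM w - dM (h (t w)) by rewrite -gmapB vr.
have -> : dM (h (t w)) = g (f (t w)) - t w - h (dM (t w)) by rewrite -hd addrK.
have -> : t (dM w + t w) = - dM (t w).
  by apply/eqP; rewrite -addr_eq0 addrC gmapD addrA tP.
by rewrite gmapN opprK !opprD !opprK !addrA [RHS]addrC !addrA [g _ + _]addrC addrK.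
Qed.

Lemma pert_fv x : f (v x) = f x.
Proof. by rewrite pert_vE gmapD fh addr0. Qed.

Lemma pert_hv x : h (v x) = h x.
Proof. by rewrite pert_vE gmapD hh addr0. Qed.

(** The inverse of [1 - t h] expressed through [v]; see [pert_ul] and [pert_ur]. *)
Definition pert_u x := x + t (v (h x)).
Definition pert_t y := f (t (v (g y))).

(** Splits the composites [f u v g] and [f u v h] into a term simplified by [f v = f] and a term
    killed by [h g = 0] or [h h = 0]. *)
Lemma pert_uv x : pert_u (v x) = v x + t (v (h x)).
Proof. by rewrite /pert_u pert_hv. Qed.

Lemma pert_hu x : h (pert_u x) = v (h x).
Proof. by rewrite [RHS]pert_vE gmapD. Qed.

Lemma pert_ul x : pert_u (x - t (h x)) = x.
Proof. by rewrite /pert_u gmapB vl subrK. Qed.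

Lemma pert_ur x : pert_u x - t (h (pert_u x)) = x.
Proof. by rewrite pert_hu addrK. Qed.

(** The mirror image of [pert_dv]: cancel [u] and write [x = w - t (h w)], now with the homotopy
    relation at [w]. *)
Lemma pert_du x :
  pert_u (dM x + t x) = dM (pert_u x) + t (v (g (f (pert_u x)))).
Proof.
rewrite -[RHS]pert_ul; congr pert_u.
move: (pert_u x) (pert_ur x) => w <-.
have -> : dM (w - t (h w)) + t (w - t (h w)) = dM w + t w + t (dM (h w)).
  rewrite !gmapB addrACA -opprD; congr (_ + _).
  by apply/eqP; rewrite eqr_oppLR -addr_eq0 addrAC tP.
rewrite !gmapD opprD addrACA -[t (v _) - _]gmapB vr.
have -> : g (f w) = dM (h w) + h (dM w) + w by rewrite hd subrK.
by rewrite !gmapD [X in _ = _ + X]addrAC addrACA addNr addr0 [RHS]addrA addrAC.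
Qed.

Lemma pert_fgE y : f (pert_u (v (g y))) = y.
Proof. by rewrite pert_uv gmapD pert_fv fg hg !gmap0 addr0. Qed.

Lemma pert_fhE x : f (pert_u (v (h x))) = 0.
Proof. by rewrite pert_uv gmapD pert_fv fh hh !gmap0 addr0. Qed.

(** As [f] and [g] are chain maps, [pert_dv] merges the last two terms into [f t (d + t) v g], and
    the whole becomes [f] applied to the equation for [t]. *)
Lemma pert_dt y :
  dN (pert_t y) + pert_t (dN y) + pert_t (pert_t y) = 0.
Proof.
rewrite /pert_t fd -gd -addrA -(gmapD f) -(gmapD t) -pert_dv -(gmapD f) (gmapD t).
by rewrite addrA tP gmap0.
Qed.

Lemma pert_dg y :
  dM (v (g y)) + t (v (g y)) = v (g (dN y + pert_t y)).
Proof. by rewrite pert_dv gd -!gmapD. Qed.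

Lemma pert_df x :
  dN (f (pert_u x)) + pert_t (f (pert_u x)) = f (pert_u (dM x + t x)).
Proof. by rewrite pert_du [RHS]gmapD fd. Qed.

(** With [pert_dv] at [h x] and [x = v (x - h (t x))], every term is an image under [v]; once [v] is
    cancelled, this is the homotopy relation at [x]. *)
Lemma pert_dh x :
  dM (v (h x)) + t (v (h x)) + v (h (dM x + t x)) = v (g (f (pert_u x))) - x.
Proof.
rewrite pert_dv -[X in _ = _ - X]vl -!(gmapD v) -gmapB; congr (v _).
by rewrite /pert_u !gmapD addrACA hd opprB addrACA [- x + _]addrC.
Qed.
End PerturbationLemma.

(** * Tensor products of perturbed maps *)

Section TensorPerturbation.
Variables (k : comPzRingType) (M N : gmod k) (X Y H : gmap 1 M M).
Variables (a b : gmap (-1) M M).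
Hypothesis XYH : forall z, X (H z) - Y (H z) = X (Y z).
Hypothesis HXY : forall z, H (X z) - H (Y z) = - X (Y z).
Hypothesis YX : forall z, Y (X z) = - X (Y z).

Section Homotopy.
Variables (Vx Vy Ux Uy : gmap 0 M M).
Hypothesis aY : forall z, a (Y z) = - Y (a z).
Hypothesis bX : forall z, b (X z) = - X (b z).
Hypothesis VxK : forall z, Vx (z - X (a z)) = z.
Hypothesis VyK : forall z, Vy (z - Y (b z)) = z.
Hypothesis UxK : forall z, Ux z - a (X (Ux z)) = z.
Hypothesis UyK : forall z, Uy z - b (Y (Uy z)) = z.
Hypothesis VyVx : forall z, Vy (Vx z) = Vx (Vy z).
Hypothesis UyUx : forall z, Uy (Ux z) = Ux (Uy z).
Hypothesis VyX : forall z, Vy (X z) = X (Vy z).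
Hypothesis UxY : forall z, Ux (Y z) = Y (Ux z).

(** Writing [X H w] as [Vy (1 - Y b) X H w] and [Y H w] as [Vx (1 - X a) Y H w], where [w = U z],
    brings [Vx Vy] out of both sides. Moving [a] and [b] past [Y] and [X] then leaves [XYH] at
    [w]. *)
Lemma pert_tensor_hl (U : gmap 0 M M) z :
  (forall z, U z - (a (H (U z)) + b (H (U z))) = z) ->
  Vx (X (H (U z))) - Vy (Y (H (U z))) = Vx (X (Vy (Y z))).
Proof.
move=> UK; move: (U z) (UK z) => w <-.
rewrite -(VyK (X (H w))) -(VxK (Y (H w))) VyVx -gmapB -gmapB -VyX.
congr (Vx (Vy _)).
rewrite bX aY (gmapN X) (gmapN Y) YX (gmapB Y) (gmapB X) -(XYH w) (gmapD Y) (gmapD X).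
zmod.
Qed.

(** Dually, [Ux Uy] is split off on the right and [V] on the left, and the remainder is [HXY] at
    [w = Ux (Uy z)]. *)
Lemma pert_tensor_hr (V : gmap 0 M M) z :
  (forall z, V (z - H (a z + b z)) = z) ->
  V (H (X (Ux z) - Y (Uy z))) = - X (Ux (Y (Uy z))).
Proof.
move=> VK; rewrite UxY -{1}(UyK (Ux z)) -{1}(UxK (Uy z)) UyUx.
move: (Ux (Uy z)) => w; rewrite -[RHS]VK; congr (V _).
have Xb s : X (b s) = - b (X s) by rewrite bX opprK.
have Ya s : Y (a s) = - a (Y s) by rewrite aY opprK.
rewrite (gmapB X) (gmapB Y) Xb Ya YX (gmapN a) (gmapN b) !(gmapB H, gmapD H, gmapN H).
have /(canRL (subrK _)) -> := HXY w; zmod.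
Qed.
End Homotopy.

Section Morphisms.
Variables (st tt : gmap (-1) M M).
Hypothesis sY : forall z, st (Y z) = - Y (st z).
Hypothesis tX : forall z, tt (X z) = - X (tt z).
Hypothesis ts : forall z, tt (st z) = - st (tt z).

(** With [st] and [tt] for [s (x) 1] and [1 (x) s], substitute [z = w - a H w - b H w] and expand.
    The terms linear in [st] or [tt] cancel under [F] by the two hypotheses on [F], and the
    quadratic ones are [st tt] applied to [XYH]. *)
Lemma pert_tensor_f (F : gmap 0 M N) (Ux Uy U : gmap 0 M M) z :
  (forall z, Ux z = z + st (X z)) -> (forall z, Uy z = z + tt (Y z)) ->
  (forall z, Ux (a z) = st z) -> (forall z, Uy (b z) = tt z) ->
  (forall z, Uy (Ux z) = Ux (Uy z)) ->
  (forall z, F (st (H z)) = F (st (X z))) ->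
  (forall z, F (tt (H z)) = F (tt (Y z))) ->
  (forall z, U z - (a (H (U z)) + b (H (U z))) = z) ->
  F (U z) = F (Ux (Uy z)).
Proof.
move=> UxE UyE Uxa Uyb UyUx FsH FtH UK.
rewrite -{2}(UK z); move: (U z) => w.
rewrite !(gmapB Uy, gmapD Uy) !(gmapB Ux, gmapD Ux) -(UyUx (a _)) Uxa Uyb.
have Yst s : Y (st s) = - st (Y s) by rewrite sY opprK.
have Xtt s : X (tt s) = - tt (X s) by rewrite tX opprK.
rewrite !UyE !UxE !(gmapD X) !Yst !Xtt -(XYH w) !(gmapN tt, gmapN st, gmapB tt, gmapD st).
rewrite !ts !(gmapD F, gmapB F, gmapN F, gmapB tt, gmapB st, gmapN st) FsH FtH.
zmod.
Qed.

(** Here [V] is cancelled instead; the quadratic terms are matched by [HXY] at [st (tt (G y))]. *)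
Lemma pert_tensor_g (G : gmap 0 N M) (Vx Vy V : gmap 0 M M) y :
  (forall z, Vx z = z + X (st z)) -> (forall z, Vy z = z + Y (tt z)) ->
  (forall z, a (Vx z) = st z) -> (forall z, b (Vy z) = tt z) ->
  (forall z, Vy (Vx z) = Vx (Vy z)) ->
  (forall z, H (st (G z)) = X (st (G z))) ->
  (forall z, H (tt (G z)) = Y (tt (G z))) ->
  (forall z, V (z - H (a z + b z)) = z) ->
  V (G y) = Vx (Vy (G y)).
Proof.
move=> VxE VyE aVx bVy VyVx HsG HtG VK; rewrite -[RHS]VK; congr (V _).
rewrite aVx -VyVx bVy VyVx !VxE !VyE !(gmapD st, gmapD tt) sY tX ts !gmapN opprK.
rewrite !(gmapD H, gmapN H) HsG HtG !(gmapD X, gmapB X, gmapN X).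
have /(canRL (subrK _)) -> := HXY (st (tt (G y))); zmod.
Qed.
End Morphisms.

(** * Consequences of differentiating the pseudo-derivation identities *)

Section Projections.
Variables (D : gmap (-1) M M) (E1 E2 : gmap 0 M M).
Hypothesis DX : forall z, D (X z) + X (D z) = E1 z - z.
Hypothesis DY : forall z, D (Y z) + Y (D z) = E2 z - z.
Hypothesis DH : forall z, D (H z) + H (D z) = E1 (E2 z) - z.
Hypothesis E1X : forall z, E1 (X z) = 0.
Hypothesis XE1 : forall z, X (E1 z) = 0.
Hypothesis E2Y : forall z, E2 (Y z) = 0.
Hypothesis YE2 : forall z, Y (E2 z) = 0.
Hypothesis E21 : forall z, E2 (E1 z) = E1 (E2 z).
Hypothesis E2X : forall z, E2 (X z) = X (E2 z).
Hypothesis E1Y : forall z, E1 (Y z) = Y (E1 z).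
Hypothesis EH : forall z, E1 (E2 (H z)) = 0.
Hypothesis HE : forall z, H (E1 (E2 z)) = 0.
Hypothesis E11 : forall z, E1 (E1 z) = E1 z.
Hypothesis E22 : forall z, E2 (E2 z) = E2 z.

Let DXE z : D (X z) = E1 z - z - X (D z).
Proof. by rewrite -DX addrK. Qed.
Let DYE z : D (Y z) = E2 z - z - Y (D z).
Proof. by rewrite -DY addrK. Qed.
Let DHE z : D (H z) = E1 (E2 z) - z - H (D z).
Proof. by rewrite -DH addrK. Qed.

(** Apply [D] to [XYH z]: the terms containing [D z] form [XYH] at [D z] and cancel. *)
Lemma diff_pseudo_derivation_l z :
  E1 (H z) - E2 (H z) = E1 (Y z) - X (E2 z).
Proof.
have := congr1 D (XYH z).
rewrite (gmapB D) !DXE DYE DHE DYE !(gmapB X) !(gmapB Y) -(XYH (D z)) -E21 YE2 E21 XE1.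
move=> /eqP; rewrite -subr_eq0 => /eqP e; apply/eqP; rewrite -subr_eq0 -e; apply/eqP.
zmod.
Qed.

Lemma diff_pseudo_derivation_r z :
  H (E1 z) - H (E2 z) = E1 (Y z) - X (E2 z).
Proof.
have := congr1 D (HXY z).
rewrite (gmapB D) (gmapN D) !DHE DXE !DXE !DYE !(gmapB X, gmapB H) E2X E1X E2Y.
have /(canRL (subrK _)) -> := HXY (D z); rewrite (gmap0 E1).
move=> /eqP; rewrite -subr_eq0 => /eqP e; apply/eqP; rewrite eq_sym -subr_eq0 -e; apply/eqP.
zmod.
Qed.

(** In this and the next three lemmas, composing with [E1] or [E2] kills one term on either side of
    the differentiated identity. *)
Lemma proj1_htpy z : E1 (H z) = E1 (Y z).
Proof.
have := congr1 E1 (diff_pseudo_derivation_l z).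
by rewrite !(gmapB E1) EH E1X !E11 !subr0.
Qed.

Lemma proj2_htpy z : E2 (H z) = E2 (X z).
Proof.
have := congr1 E2 (diff_pseudo_derivation_l z).
by rewrite !(gmapB E2) E21 EH E21 E2Y gmap0 E22 E2X E22 !sub0r => /oppr_inj ->.
Qed.

Lemma htpy_proj1 z : H (E1 z) = Y (E1 z).
Proof.
have := diff_pseudo_derivation_r (E1 z).
by rewrite E11 E21 HE XE1 E1Y E11 !subr0.
Qed.

Lemma htpy_proj2 z : H (E2 z) = X (E2 z).
Proof.
have := diff_pseudo_derivation_r (E2 z).
by rewrite E22 HE YE2 gmap0 !sub0r => /oppr_inj ->.
Qed.
End Projections.
End TensorPerturbation.

(** * The perturbed contraction *)

Section TensorFactors.
Variables (k : comPzRingType) (A : gmod k) (p q : nat).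

Definition tensl r (f : gmap r (tpow A p) (tpow A p)) := tens f (tone A q).
Definition tensr r (f : gmap r (tpow A q) (tpow A q)) := tens (tone A p) f.

Lemma tensl_comp r s r' (f : gmap r (tpow A p) (tpow A p))
    (g : gmap s (tpow A p) (tpow A p)) (fg : gmap r' (tpow A p) (tpow A p)) :
  f \o g =1 fg -> forall x, tensl f (tensl g x) = tensl fg x.
Proof. by move=> E x; rewrite (tens_comp (f'' := fg) (g'' := tone A q)) ?scale1r. Qed.

Lemma tensr_comp r s r' (f : gmap r (tpow A q) (tpow A q))
    (g : gmap s (tpow A q) (tpow A q)) (fg : gmap r' (tpow A q) (tpow A q)) :
  s + r = r' -> f \o g =1 fg -> forall x, tensr f (tensr g x) = tensr fg x.
Proof.
move=> e E x; rewrite (tens_comp (f'' := tone A p) _ _ E) // 1?addrC //.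
by rewrite koszul0r scale1r.
Qed.

Lemma tensl_r r s (f : gmap r (tpow A p) (tpow A p))
    (g : gmap s (tpow A q) (tpow A q)) x :
  tensl f (tensr g x) = tens f g x.
Proof. by rewrite (tens_comp (f'' := f) (g'' := g)) ?add0r // scale1r. Qed.

Lemma tensr_l r s (f : gmap r (tpow A p) (tpow A p))
    (g : gmap s (tpow A q) (tpow A q)) x :
  tensr g (tensl f x) = koszul k s r *: tens f g x.
Proof. by rewrite (tens_comp (f'' := f) (g'' := g)) ?addr0. Qed.

Lemma tensrlC r s (f : gmap r (tpow A p) (tpow A p))
    (g : gmap s (tpow A q) (tpow A q)) x :
  koszul k s r = 1 -> tensr g (tensl f x) = tensl f (tensr g x).
Proof. by move=> e; rewrite tensl_r tensr_l e scale1r. Qed.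

Lemma tensrlN r s (f : gmap r (tpow A p) (tpow A p))
    (g : gmap s (tpow A q) (tpow A q)) x :
  koszul k s r = -1 -> tensr g (tensl f x) = - tensl f (tensr g x).
Proof. by move=> e; rewrite tensl_r tensr_l e scaleN1r. Qed.

Lemma tensl_affine r s (w : gmap 0 (tpow A p) (tpow A p))
    (f : gmap r (tpow A p) (tpow A p)) (g : gmap s (tpow A p) (tpow A p)) :
  s + r = 0 -> (forall x, w x = x + f (g x)) ->
  forall x, tensl w x = x + tensl f (tensl g x).
Proof.
move=> e E x; rewrite (@tensl_comp _ _ _ _ _ (gcomp e f g)) // [RHS]addrC.
rewrite /tensl (@tensPl _ _ _ _ _ _ _ 1 w (gcomp e f g) (tone A p)) => [|y].
  by rewrite scale1r tens1.
by rewrite E scale1r addrC.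
Qed.

Lemma tensr_affine r s (w : gmap 0 (tpow A q) (tpow A q))
    (f : gmap r (tpow A q) (tpow A q)) (g : gmap s (tpow A q) (tpow A q)) :
  s + r = 0 -> (forall x, w x = x + f (g x)) ->
  forall x, tensr w x = x + tensr f (tensr g x).
Proof.
move=> e E x; rewrite (@tensr_comp _ _ _ _ _ (gcomp e f g)) // [RHS]addrC.
rewrite /tensr (@tensPr _ _ _ _ _ _ _ 1 _ w (gcomp e f g) (tone A q)) => [|y].
  by rewrite scale1r tens1.
by rewrite E scale1r addrC.
Qed.

Lemma tensl0 r (f : gmap r (tpow A p) (tpow A p)) x :
  (forall y, f y = 0) -> tensl f x = 0.
Proof.
move=> E; elim/tpow_cat_ind: x => [|c a b x IH]; first by rewrite gmap0.
by rewrite gmapP IH tens_gen_cat E tcat0l !scaler0 addr0.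
Qed.

Lemma tensr0 r (f : gmap r (tpow A q) (tpow A q)) x :
  (forall y, f y = 0) -> tensr f x = 0.
Proof.
move=> E; elim/tpow_cat_ind: x => [|c a b x IH]; first by rewrite gmap0.
by rewrite gmapP IH tens_gen_cat E tcat0r !scaler0 addr0.
Qed.

Lemma tensl_comp0 r s (f : gmap r (tpow A p) (tpow A p))
    (g : gmap s (tpow A p) (tpow A p)) x :
  (forall y, f (g y) = 0) -> tensl f (tensl g x) = 0.
Proof. by move=> E; rewrite (tensl_comp (fg := gcomp (erefl (s + r)) f g)) ?tensl0. Qed.

Lemma tensl_htpy r s (f : gmap r (tpow A p) (tpow A p))
    (g : gmap s (tpow A p) (tpow A p)) (w : gmap 0 (tpow A p) (tpow A p)) :
  s + r = 0 -> (forall x, f (g x) + g (f x) = w x - x) ->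
  forall x, tensl f (tensl g x) + tensl g (tensl f x) = tensl w x - x.
Proof.
move=> e E x; have e' : r + s = 0 by rewrite addrC.
pose fg := gcomp e f g; pose gf := gcomp e' g f.
rewrite (tensl_comp (fg := fg)) // (tensl_comp (fg := gf)) //.
have E1 y : gadd fg gf y = 1 *: fg y + gf y by rewrite scale1r.
have E2 y : w y = 1 *: gadd fg gf y + tone A p y by rewrite scale1r /= E subrK.
rewrite /tensl (tensPl (tone A q) E2) (tensPl (tone A q) E1).
by rewrite !scale1r tens1 addrK.
Qed.

Lemma tensr_comp0 r s (f : gmap r (tpow A q) (tpow A q))
    (g : gmap s (tpow A q) (tpow A q)) x :
  (forall y, f (g y) = 0) -> tensr f (tensr g x) = 0.
Proof. by move=> E; rewrite (tensr_comp (fg := gcomp (erefl (s + r)) f g)) ?tensr0. Qed.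

Lemma tensr_htpy r s (f : gmap r (tpow A q) (tpow A q))
    (g : gmap s (tpow A q) (tpow A q)) (w : gmap 0 (tpow A q) (tpow A q)) :
  s + r = 0 -> (forall x, f (g x) + g (f x) = w x - x) ->
  forall x, tensr f (tensr g x) + tensr g (tensr f x) = tensr w x - x.
Proof.
move=> e E x; have e' : r + s = 0 by rewrite addrC.
pose fg := gcomp e f g; pose gf := gcomp e' g f.
rewrite (tensr_comp (fg := fg)) // (tensr_comp (fg := gf)) //.
have E1 y : gadd fg gf y = 1 *: fg y + gf y by rewrite scale1r.
have E2 y : w y = 1 *: gadd fg gf y + tone A q y by rewrite scale1r /= E subrK.
rewrite /tensr (tensPr (tone A p) E2) (tensPr (tone A p) E1).
by rewrite !scale1r tens1 addrK.
Qed.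
End TensorFactors.

(** If [v] inverts [1 - f g], then [1 + g v f] inverts [1 - g f]. *)
Lemma invertible_swap (k : comPzRingType) (A : gmod k) r s
    (f : thick r A A) (g : thick s A A) :
  r + s = 0 ->
  thick_invertible (fun n x => x - f n (g n x)) ->
  thick_invertible (fun n x => x - g n (f n x)).
Proof.
move=> e [v vP]; have e' : r + 0 = r by rewrite addr0.
exists (tadd (tone A) (tcomp e g (tcomp e' v f))) => n x /=.
have [vl vr] := vP n (f n x); split.
  by rewrite (gmapB (f n)) vl subrK.
have -> : f n (x + g n (v n (f n x))) = v n (f n x).
  by rewrite gmapD -{1}vr subrK.
by rewrite addrK.
Qed.

(** * Thick maps of coalgebras *)

Section CoalgebraThick.
Variables (k : comPzRingType) (C : symseq k).
Implicit Types (A B D : gmod k).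

Lemma coalgebra_thick_one A (DA : gmap 0 A (schur C A)) :
  is_coalgebra_thick DA DA (tone A).
Proof. by split=> // x; rewrite schur_thick_one. Qed.

Lemma coalgebra_thick_comp A B D r s q (DA : gmap 0 A (schur C A))
    (DB : gmap 0 B (schur C B)) (DD : gmap 0 D (schur C D))
    (e : r + s = q) (g : thick s B D) (f : thick r A B) :
  is_coalgebra_thick DB DD g -> is_coalgebra_thick DA DB f ->
  is_coalgebra_thick DA DD (tcomp e g f).
Proof.
move=> [gS gD] [fS fD]; have gfS := tcomp_sym e gS fS; split=> // x.
by rewrite [LHS]gD fD (schur_thick_comp e fS gS gfS).
Qed.

Lemma coalgebra_thick_add A B r (DA : gmap 0 A (schur C A))
    (DB : gmap 0 B (schur C B)) (f g : thick r A B) :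
  is_coalgebra_thick DA DB f -> is_coalgebra_thick DA DB g ->
  is_coalgebra_thick DA DB (tadd f g).
Proof.
move=> [fS fD] [gS gD]; have fgS := tadd_sym fS gS; split=> // x.
rewrite (@schur_thick_lin _ _ _ _ _ 1 (tadd f g) f g) //; last first.
  by move=> n y; rewrite scale1r.
by rewrite scale1r -fD -gD -!gmapD.
Qed.

Lemma coalgebra_thick_sub A B r (DA : gmap 0 A (schur C A))
    (DB : gmap 0 B (schur C B)) (f g : thick r A B) :
  is_coalgebra_thick DA DB f -> is_coalgebra_thick DA DB g ->
  is_coalgebra_thick DA DB (tsub f g).
Proof.
move=> [fS fD] [gS gD]; have fgS := tsub_sym fS gS; split=> // x.
rewrite (@schur_thick_lin _ _ _ _ _ (-1) (tsub f g) g f) //; last first.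
  by move=> n y; rewrite scaleN1r addrC.
by rewrite scaleN1r addrC -fD -gD -!gmapB.
Qed.

(** Apply [C[v]] to [Delta u = C[u] Delta] taken at [v x], and use [C[v] C[u] = 1]. *)
Lemma coalgebra_thick_inv A (DA : gmap 0 A (schur C A)) (u v : thick 0 A A) :
  (forall n, cancel (u n) (v n)) -> (forall n, cancel (v n) (u n)) ->
  is_coalgebra_thick DA DA u -> is_coalgebra_thick DA DA v.
Proof.
move=> uK vK [uS uD]; have vS := inv_sym uK vK uS; split=> // x.
by rewrite -{2}(vK 1%N x) uD (schur_thick_comp (gf := tone A)) ?schur_thick_one.
Qed.
End CoalgebraThick.

(** Only the differential changes, so coassociativity and the counit law carry over. That [d + t_1]
    squares to zero is checked on the first tensor power, where the equation for [t] lives. *)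
Lemma coalgebra_pert (k : comPzRingType) (C : cooperad k) (A : gmod k)
    (d : gmap (-1) A A) (D : gmap 0 A (schur C A)) (t : thick (-1) A A) :
  is_coalgebra d D -> is_perturbation d D t -> is_coalgebra (pert_diff d t) D.
Proof.
move=> [dd dD assD unitD] [[[tS tC] tD] tP]; split=> // x.
  rewrite -(tinK x); move: (tin A x) => {}x.
  have dE y : pert_diff d t (tout A y) = tout A (tdiff d 1 y + t 1%N y).
    by rewrite gmapD tdiff1 tinK -[LHS]/(pert_fun _ _ _) /pert_fun toutK.
  rewrite dE dE -[RHS](gmap0 (tout A)) -(tP 1%N x); congr (tout A _).
  have ddx : tdiff d 1 (tdiff d 1 x) = 0 by rewrite !tdiff1 tinK dd gmap0.
  by rewrite !gmapD ddx /thick_bd [koszul _ _ _]expr1 scaleN1r; zmod.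
rewrite schur_diff_pert // -dD -[in RHS](tinK x) -tC tinK -gmapD.
by congr (D (_ + _)).
Qed.

(** * The perturbed thick maps and their multiplicative properties *)

Section ThickPerturbation.
Variables (k : comPzRingType) (A B : gmod k).
Variables (dA : gmap (-1) A A) (dB : gmap (-1) B B).
Variables (f : thick 0 A B) (g : thick 0 B A) (h : thick 1 A A).
Variables (t : thick (-1) A A) (v : thick 0 A A).
Hypothesis df : forall n x, tdiff dB n (f n x) = f n (tdiff dA n x).
Hypothesis dg : forall n x, tdiff dA n (g n x) = g n (tdiff dB n x).
Hypothesis dh : forall n x,
  tdiff dA n (h n x) + h n (tdiff dA n x) = g n (f n x) - x.
Hypothesis fg : forall n x, f n (g n x) = x.
Hypothesis fh : forall n x, f n (h n x) = 0.
Hypothesis hh : forall n x, h n (h n x) = 0.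
Hypothesis hg : forall n x, h n (g n x) = 0.
Hypothesis f_mor : is_morphism f.
Hypothesis g_mor : is_morphism g.
Hypothesis h_pd : is_pseudo_derivation h.
Hypothesis t_der : is_derivation t.
Hypothesis vl : forall n x, v n (x - h n (t n x)) = x.
Hypothesis vr : forall n x, v n x - h n (t n (v n x)) = x.

(** Levelwise these definitions unfold to the maps of the one-level perturbation lemma, [u] to
    [pert_u], so its results apply by conversion. *)
Definition pert_thick_s : thick (-1) A A := tcomp (add0r (-1)) t v.
Definition pert_thick_u : thick 0 A A := tadd (tone A) (tcomp (subrr 1) pert_thick_s h).
Definition pert_thick_f : thick 0 A B := tcomp (addr0 0) f pert_thick_u.
Definition pert_thick_g : thick 0 B A := tcomp (addr0 0) v g.
Definition pert_thick_h : thick 1 A A := tcomp (addr0 1) v h.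
Definition pert_thick_t : thick (-1) B B :=
  tcomp (addr0 (-1)) f (tcomp (add0r (-1)) t pert_thick_g).

Local Notation u := pert_thick_u.
Local Notation f' := pert_thick_f.
Local Notation g' := pert_thick_g.
Local Notation h' := pert_thick_h.
Local Notation t' := pert_thick_t.

Let P : thick 0 A A := tcomp (addr0 0) g f.

Let uE n x : u n x = pert_u (t n) (h n) (v n) x.
Proof. by []. Qed.

Let hu n x : h n (u n x) = h' n x.
Proof. by rewrite uE (pert_hu (@vr n)). Qed.

Let ur n x : u n x - t n (h n (u n x)) = x.
Proof. by rewrite uE (pert_ur (@vr n)). Qed.

Let ut n x : u n (t n x) = pert_thick_s n x.
Proof. by rewrite [RHS](congr1 (t n) (pert_vE' (@vl n) x)) gmapD. Qed.

Let vE n x : v n x = x + h n (t n (v n x)).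
Proof. exact: (pert_vE (@vr n)). Qed.

Lemma pert_series : is_perturbation_series f g h t f' g' h' t'.
Proof.
split=> n x //.
- by rewrite -[f' n (t n _)]/(f n (u n (t n (h n x)))) ut -gmapD.
- exact: (pert_vE (@vr n)).
- exact: (pert_vE' (@vl n)).
Qed.

(** The recursions say [f1 (1 - th) = f], [(1 - ht) g1 = g] and [h1 (1 - th) = h], and both factors
    are invertible. *)
Lemma pert_series_uniq f1 g1 h1 t1 : is_perturbation_series f g h t f1 g1 h1 t1 ->
  forall n, [/\ f1 n =1 f' n, g1 n =1 g' n, h1 n =1 h' n & t1 n =1 t' n].
Proof.
move=> [f1E g1E h1E t1E] n.
have g1' x : g1 n x = g' n x.
  by rewrite /= -[LHS](@vl n) {1}g1E addrK.
split=> x //; last by rewrite t1E g1'.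
  by rewrite -{1}(ur x) gmapB f1E addrK.
by rewrite -{1}(ur x) gmapB h1E addrK hu.
Qed.

Section Factors.
Variables p q : nat.
Local Notation L := (tensl q).
Local Notation R := (tensr p).

Let LRN r s (a : gmap r (tpow A p) (tpow A p)) (b : gmap s (tpow A q) (tpow A q)) x :
  koszul k s r = -1 -> L a (R b x) = - R b (L a x).
Proof. by move=> e; rewrite tensrlN ?opprK. Qed.

Let XYH z : L (h p) (h (p + q)%N z) - R (h q) (h (p + q)%N z) = L (h p) (R (h q) z).
Proof. by rewrite tensl_r (h_pd z).1. Qed.

Let HXY z : h (p + q)%N (L (h p) z) - h (p + q)%N (R (h q) z) = - L (h p) (R (h q) z).
Proof. by rewrite tensl_r -gmapB (h_pd z).2. Qed.

Let Lh' z : L (h' p) z = L (v p) (L (h p) z).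
Proof. by rewrite (tensl_comp (fg := h' p)). Qed.
Let Rh' z : R (h' q) z = R (v q) (R (h q) z).
Proof. by rewrite (tensr_comp (fg := h' q)). Qed.
Let Lhu z : L (h' p) z = L (h p) (L (u p) z).
Proof. by rewrite (tensl_comp (fg := h' p)) // => x; exact: hu. Qed.
Let Rhu z : R (h' q) z = R (h q) (R (u q) z).
Proof. by rewrite (tensr_comp (fg := h' q)) // => x; exact: hu. Qed.

Let LvK z : L (v p) (z - L (h p) (L (t p) z)) = z.
Proof.
rewrite gmapB -Lh' (@tensl_affine _ _ _ _ _ _ _ (h' p) (t p)) ?addrK // => x.
exact: (pert_vE' (@vl p)).
Qed.
Let RvK z : R (v q) (z - R (h q) (R (t q) z)) = z.
Proof.
rewrite gmapB -Rh' (@tensr_affine _ _ _ _ _ _ _ (h' q) (t q)) ?addrK // => x.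
exact: (pert_vE' (@vl q)).
Qed.
Let LuK z : L (u p) z - L (t p) (L (h p) (L (u p) z)) = z.
Proof.
by rewrite -Lhu {1}(@tensl_affine _ _ _ _ _ _ _ (t p) (h' p)) ?addrK.
Qed.
Let RuK z : R (u q) z - R (t q) (R (h q) (R (u q) z)) = z.
Proof.
by rewrite -Rhu {1}(@tensr_affine _ _ _ _ _ _ _ (t q) (h' q)) ?addrK.
Qed.

Let T_tot z : t (p + q)%N z = L (t p) z + R (t q) z.
Proof. exact: t_der. Qed.

Let U_tot z : u (p + q)%N z -
  (L (t p) (h (p + q)%N (u (p + q)%N z)) + R (t q) (h (p + q)%N (u (p + q)%N z))) = z.
Proof. by rewrite -T_tot ur. Qed.

Let V_tot z : v (p + q)%N (z - h (p + q)%N (L (t p) z + R (t q) z)) = z.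
Proof. by rewrite -T_tot vl. Qed.

Let YX z : R (h q) (L (h p) z) = - L (h p) (R (h q) z).
Proof. exact: tensrlN. Qed.
Let aY z : L (t p) (R (h q) z) = - R (h q) (L (t p) z).
Proof. exact: LRN. Qed.
Let bX z : R (t q) (L (h p) z) = - L (h p) (R (t q) z).
Proof. exact: tensrlN. Qed.

(** Taking [h' = v h] on the factors but [h' = h u] on the full tensor power gives the shape of
    [pert_tensor_hl]; in [pert_h_right] the roles are exchanged. *)
Lemma pert_h_left z :
  L (h' p) (h' (p + q)%N z) - R (h' q) (h' (p + q)%N z) = tens (h' p) (h' q) z.
Proof.
rewrite -tensl_r !Lh' !Rh' -!hu.
apply: (pert_tensor_hl XYH YX aY bX LvK RvK _ _ _ U_tot) => z'; exact: tensrlC.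
Qed.

Lemma pert_h_right z :
  h' (p + q)%N (L (h' p) z - R (h' q) z) = - tens (h' p) (h' q) z.
Proof.
rewrite -tensl_r !Lhu !Rhu.
apply: (pert_tensor_hr HXY YX aY bX LuK RuK _ _ _ V_tot) => z'; rewrite -?tensrlC //.
Qed.

Let LvE z : L (v p) z = z + L (h p) (L (pert_thick_s p) z).
Proof. by apply: tensl_affine. Qed.
Let RvE z : R (v q) z = z + R (h q) (R (pert_thick_s q) z).
Proof. by apply: tensr_affine. Qed.
Let LuE z : L (u p) z = z + L (pert_thick_s p) (L (h p) z).
Proof. by apply: tensl_affine. Qed.
Let RuE z : R (u q) z = z + R (pert_thick_s q) (R (h q) z).
Proof. by apply: tensr_affine. Qed.
Let Lut z : L (u p) (L (t p) z) = L (pert_thick_s p) z.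
Proof. by apply: tensl_comp => x; exact: ut. Qed.
Let Rut z : R (u q) (R (t q) z) = R (pert_thick_s q) z.
Proof. by apply: tensr_comp => // x; exact: ut. Qed.
Let Ltv z : L (t p) (L (v p) z) = L (pert_thick_s p) z.
Proof. by apply: tensl_comp. Qed.
Let Rtv z : R (t q) (R (v q) z) = R (pert_thick_s q) z.
Proof. by apply: tensr_comp. Qed.
Let sY z : L (pert_thick_s p) (R (h q) z) = - R (h q) (L (pert_thick_s p) z).
Proof. exact: LRN. Qed.
Let tX z : R (pert_thick_s q) (L (h p) z) = - L (h p) (R (pert_thick_s q) z).
Proof. exact: tensrlN. Qed.
Let ts z : R (pert_thick_s q) (L (pert_thick_s p) z) = - L (pert_thick_s p) (R (pert_thick_s q) z).
Proof. exact: tensrlN. Qed.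

Let fgf n x : f n (P n x) = f n x. Proof. exact: fg. Qed.
Let fF z : f (p + q)%N z = tens (f p) (f q) z. Proof. exact: f_mor. Qed.
Let gG z : g (p + q)%N z = tens (g p) (g q) z. Proof. exact: g_mor. Qed.

(** As [f g = 1], the map [f (x) f] absorbs [gf (x) 1]; inserting such projections gives access to
    the relations between [E1], [E2] and [H]. *)
Let FL z : f (p + q)%N (L (P p) z) = f (p + q)%N z.
Proof. by rewrite !fF (tens_comp (f'' := f p) (g'' := f q)) ?scale1r //; exact: fgf. Qed.
Let FR z : f (p + q)%N (R (P q) z) = f (p + q)%N z.
Proof. by rewrite !fF (tens_comp (f'' := f p) (g'' := f q)) ?scale1r //; exact: fgf. Qed.

Let Pg n y : P n (g n y) = g n y. Proof. by rewrite /= fg. Qed.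
Let LG y : L (P p) (g (p + q)%N y) = g (p + q)%N y.
Proof. by rewrite !gG (tens_comp (f'' := g p) (g'' := g q)) ?scale1r //; exact: Pg. Qed.
Let RG y : R (P q) (g (p + q)%N y) = g (p + q)%N y.
Proof. by rewrite !gG (tens_comp (f'' := g p) (g'' := g q)) ?scale1r //; exact: Pg. Qed.

Let PP z : L (P p) (R (P q) z) = g (p + q)%N (f (p + q)%N z).
Proof. by rewrite tensl_r fF gG (tens_comp (f'' := P p) (g'' := P q)) ?scale1r. Qed.

Let DX z : tdiff dA (p + q) (L (h p) z) + L (h p) (tdiff dA (p + q) z) = L (P p) z - z.
Proof.
(* The differential of the right factor anticommutes with [h (x) 1], so only the homotopy relation
   in the left factor remains. *)
rewrite !tdiff_tens gmapD addrACA.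
rewrite -/(L (tdiff dA p)) -/(R (tdiff dA q)).
rewrite (tensl_htpy (w := P p)) //.
by rewrite tensrlN // addNr addr0.
Qed.
Let DY z : tdiff dA (p + q) (R (h q) z) + R (h q) (tdiff dA (p + q) z) = R (P q) z - z.
Proof.
rewrite !tdiff_tens gmapD addrACA -/(L (tdiff dA p)) -/(R (tdiff dA q)).
rewrite (tensr_htpy (w := P q)) //.
by rewrite LRN // addNr add0r.
Qed.
Let DH z : tdiff dA (p + q) (h (p + q)%N z) + h (p + q)%N (tdiff dA (p + q) z) =
  L (P p) (R (P q) z) - z.
Proof. by rewrite PP dh. Qed.
Let hP n x : h n (P n x) = 0. Proof. exact: hg. Qed.
Let Ph n x : P n (h n x) = 0. Proof. by rewrite /= fh gmap0. Qed.
Let PPn n x : P n (P n x) = P n x. Proof. by rewrite /= fg. Qed.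
Let E1X z : L (P p) (L (h p) z) = 0. Proof. exact: tensl_comp0. Qed.
Let XE1 z : L (h p) (L (P p) z) = 0. Proof. exact: tensl_comp0. Qed.
Let E2Y z : R (P q) (R (h q) z) = 0. Proof. exact: tensr_comp0. Qed.
Let YE2 z : R (h q) (R (P q) z) = 0. Proof. exact: tensr_comp0. Qed.
Let E21 z : R (P q) (L (P p) z) = L (P p) (R (P q) z). Proof. exact: tensrlC. Qed.
Let E2X z : R (P q) (L (h p) z) = L (h p) (R (P q) z). Proof. exact: tensrlC. Qed.
Let E1Y z : L (P p) (R (h q) z) = R (h q) (L (P p) z).
Proof. by rewrite tensrlC ?koszul0r. Qed.
Let EH z : L (P p) (R (P q) (h (p + q)%N z)) = 0.
Proof. by rewrite PP fh gmap0. Qed.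
Let HE z : h (p + q)%N (L (P p) (R (P q) z)) = 0.
Proof. by rewrite PP hg. Qed.
Let E11 z : L (P p) (L (P p) z) = L (P p) z.
Proof. by apply: tensl_comp => x; exact: PPn. Qed.
Let E22 z : R (P q) (R (P q) z) = R (P q) z.
Proof. by apply: tensr_comp => // x; exact: PPn. Qed.

(** Insert [1 (x) gf] after [f], move it past [s (x) 1], and use [E2 H = E2 X]; [FtH], [HsG] and
    [HtG] follow the same pattern. *)
Let FsH z : f (p + q)%N (L (pert_thick_s p) (h (p + q)%N z)) =
  f (p + q)%N (L (pert_thick_s p) (L (h p) z)).
Proof.
rewrite -FR -[RHS]FR !(tensrlC (pert_thick_s p)) //.
by rewrite (proj2_htpy XYH DX DY DH XE1 E2Y YE2 E21 E2X EH E22).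
Qed.

Let LPC z : L (P p) (R (pert_thick_s q) z) = R (pert_thick_s q) (L (P p) z).
Proof. by rewrite tensrlC ?koszul0r. Qed.

Let FtH z : f (p + q)%N (R (pert_thick_s q) (h (p + q)%N z)) =
  f (p + q)%N (R (pert_thick_s q) (R (h q) z)).
Proof.
rewrite -FL -[RHS]FL !LPC.
by rewrite (proj1_htpy XYH DX DY DH E1X XE1 YE2 E21 EH E11).
Qed.

Let HsG y : h (p + q)%N (L (pert_thick_s p) (g (p + q)%N y)) =
  L (h p) (L (pert_thick_s p) (g (p + q)%N y)).
Proof.
rewrite -RG -(tensrlC (pert_thick_s p)) //.
by rewrite (htpy_proj2 HXY DX DY DH E1X E2Y YE2 E2X HE E22).
Qed.

Let HtG y : h (p + q)%N (R (pert_thick_s q) (g (p + q)%N y)) =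
  R (h q) (R (pert_thick_s q) (g (p + q)%N y)).
Proof.
rewrite -LG -LPC.
by rewrite (htpy_proj1 HXY DX DY DH E1X XE1 E2Y E21 E2X E1Y HE E11).
Qed.

Lemma pert_f_mor z : f' (p + q)%N z = tens (f' p) (f' q) z.
Proof.
transitivity (f (p + q)%N (L (u p) (R (u q) z))).
  apply: (pert_tensor_f XYH sY tX ts z LuE RuE Lut Rut _ FsH FtH U_tot) => z'.
  exact: tensrlC.
by rewrite tensl_r fF (tens_comp (f'' := f' p) (g'' := f' q)) ?scale1r.
Qed.

Lemma pert_g_mor z : g' (p + q)%N z = tens (g' p) (g' q) z.
Proof.
transitivity (L (v p) (R (v q) (g (p + q)%N z))).
  apply: (pert_tensor_g HXY sY tX ts z LvE RvE Ltv Rtv _ HsG HtG V_tot) => z'.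
  exact: tensrlC.
by rewrite tensl_r gG (tens_comp (f'' := g' p) (g'' := g' q)) ?scale1r.
Qed.

(** In each summand the factor that [t] does not touch becomes [f g' = 1]. *)
Lemma pert_t_der z :
  t' (p + q)%N z = tens (t' p) (tone B q) z + tens (tone B p) (t' q) z.
Proof.
have fg' n y : f n (g' n y) = y by rewrite /= (pert_fv (@fh n) (@vr n)) fg.
have -> : t' (p + q)%N z = f (p + q)%N (t (p + q)%N (g' (p + q)%N z)) by [].
rewrite pert_g_mor T_tot gmapD !fF; congr (_ + _).
  rewrite (tens_comp (f'' := tcomp (add0r (-1)) t g' p) (g'' := g' q)) // scale1r.
  rewrite (tens_comp (f'' := t' p) (g'' := tone B q)) ?scale1r //; exact: fg'.
rewrite (tens_comp (f'' := g' p) (g'' := tcomp (add0r (-1)) t g' q)) // scale1r.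
rewrite (tens_comp (f'' := tone B p) (g'' := t' q)) ?scale1r //; exact: fg'.
Qed.
End Factors.
End ThickPerturbation.

(** * Assembly of the perturbed contraction *)

Theorem theorem9p4 (k : comPzRingType) (C : cooperad k) (A B : gmod k)
  (dA : gmap (-1) A A) (DA : gmap 0 A (schur C A))
  (dB : gmap (-1) B B) (DB : gmap 0 B (schur C B))
  (hA : is_coalgebra dA DA) (hB : is_coalgebra dB DB)
  (f : thick 0 A B) (g : thick 0 B A) (h : thick 1 A A)
  (hc : is_contraction dA DA dB DB f g h)
  (t : thick (-1) A A) (ht : is_perturbation dA DA t) :
  (thick_invertible (fun n x => x - h n (t n x)) <->
   thick_invertible (fun n x => x - t n (h n x))) /\
  (thick_invertible (fun n x => x - h n (t n x)) ->
   exists (f' : thick 0 A B) (g' : thick 0 B A) (h' : thick 1 A A) (t' : thick (-1) B B),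
     [/\ is_perturbation_series f g h t f' g' h' t',
         forall f1 g1 h1 t1, is_perturbation_series f g h t f1 g1 h1 t1 ->
           forall n, [/\ f1 n =1 f' n, g1 n =1 g' n, h1 n =1 h' n & t1 n =1 t' n],
         is_perturbation dB DB t',
         is_coalgebra (pert_diff dA t) DA /\ is_coalgebra (pert_diff dB t') DB &
         is_contraction (pert_diff dA t) DA (pert_diff dB t') DB f' g' h']).
Proof.
split; first by split; apply: invertible_swap.
case: hc => fC gC hC fd gd hd fg fh hh hg f_mor g_mor h_pd.
case: (ht) => -[tC t_der] tP [v vP].
have vl n x : v n (x - h n (t n x)) = x by case: (vP n x).
have vr n x : v n x - h n (t n (v n x)) = x by case: (vP n x).
have df n x : tdiff dB n (f n x) = f n (tdiff dA n x).
  by have /subr0_eq := fd n x; rewrite scale1r.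
have dg n x : tdiff dA n (g n x) = g n (tdiff dB n x).
  by have /subr0_eq := gd n x; rewrite scale1r.
have dh n x : tdiff dA n (h n x) + h n (tdiff dA n x) = g n (f n x) - x.
  by rewrite -hd /thick_bd [koszul _ _ _]expr1 scaleN1r opprK.
have dt n x : tdiff dA n (t n x) + t n (tdiff dA n x) + t n (t n x) = 0.
  by rewrite -(tP n x) /thick_bd [koszul _ _ _]expr1 scaleN1r opprK.
pose f' := pert_thick_f f h t v; pose g' := pert_thick_g g v.
pose h' := pert_thick_h h v; pose t' := pert_thick_t f g t v.
(* [1 - h t] is a thick map of coalgebras, hence so is its inverse [v]; the perturbed maps arise
   from it by sums and composites. *)
have vC : is_coalgebra_thick DA DA v.
  have := coalgebra_thick_sub (coalgebra_thick_one DA)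
    (coalgebra_thick_comp (addNr 1) hC tC).
  by apply: coalgebra_thick_inv => n x /=; rewrite ?vl ?vr.
have uC : is_coalgebra_thick DA DA (pert_thick_u h t v).
  apply: coalgebra_thick_add; first exact: coalgebra_thick_one.
  exact: (coalgebra_thick_comp _ (coalgebra_thick_comp _ tC vC) hC).
have f'C : is_coalgebra_thick DA DB f' by exact: (coalgebra_thick_comp _ fC uC).
have g'C : is_coalgebra_thick DB DA g' by exact: (coalgebra_thick_comp _ vC gC).
have h'C : is_coalgebra_thick DA DA h' by exact: (coalgebra_thick_comp _ vC hC).
have t'C : is_coalgebra_thick DB DB t'.
  exact: (coalgebra_thick_comp _ fC (coalgebra_thick_comp _ tC g'C)).
(* This comes first because the differential induced on the tensor powers of [B] is computed from
   the derivation property of [t']. *)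
have t'P : is_perturbation dB DB t'.
  split=> [|n x].
    split=> // p q x; exact: pert_t_der.
  rewrite /thick_bd [koszul _ _ _]expr1 scaleN1r opprK.
  exact: (pert_dt (@dt n) (@df n) (@dg n) (@dh n) (@vl n) (@vr n)).
exists f', g', h', t'; split.
- exact: pert_series.
- exact: pert_series_uniq.
- exact: t'P.
- by split; apply: coalgebra_pert.
have dAE n x : tdiff (pert_diff dA t) n x = tdiff dA n x + t n x by apply: tdiff_pert.
have dBE n x : tdiff (pert_diff dB t') n x = tdiff dB n x + t' n x.
  by apply: tdiff_pert; case: t'P => -[].
split=> // [n x|n x|n x|n x|n x|n x|n x|p q x|p q x|p q x].
- rewrite /thick_bd scale1r dAE dBE.
  by rewrite [X in X - _](pert_df (@dt n) (@df n) (@dh n) (@vl n) (@vr n)) subrr.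
- rewrite /thick_bd scale1r dAE dBE.
  by rewrite [X in X - _](pert_dg (@dt n) (@dg n) (@dh n) (@vl n) (@vr n)) subrr.
- rewrite /thick_bd [koszul _ _ _]expr1 scaleN1r opprK !dAE.
  exact: (pert_dh (@dt n) (@dh n) (@vl n) (@vr n)).
- exact: (pert_fgE (@fg n) (@fh n) (@hh n) (@hg n) (@vr n)).
- exact: (pert_fhE (@fh n) (@hh n) (@vr n)).
- by rewrite /= (pert_hv (@hh n) (@vr n)) hh gmap0.
- by rewrite /= (pert_hv (@hh n) (@vr n)) hg gmap0.
- exact: pert_f_mor.
- exact: pert_g_mor.
- split; first exact: pert_h_left.
  exact: pert_h_right.
Qed.
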